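(* Let $\mathcal{A}_0$ and $\mathcal{A}_1$ be well-behaved online BST data structures on $n$ keys. Then there exists a well-behaved online BST data structure $\mathcal{D}$ such that for every online access sequence $X$, every contiguous subsequence $Z$ of $X$, and every initial tree $T$, \[ \tau_{\mathcal{D}}(T,X,Z) < c\cdot\min\big(\tau_{\mathcal{A}_0}(T,X,Z),\tau_{\mathcal{A}_1}(T,X,Z)\big)+c'\cdot n \] for some constants $c,c'$. If $\mathcal{A}_0$ and $\mathcal{A}_1$ are real-world BST data structures, then so is $\mathcal{D}$.
   Context: BST model: a set of $n$ keys is stored in a binary search tree with parent/left/right pointers and augmented data per node; a single finger starts at the root; unit-cost operations are moving the finger to its left child, right child or parent, and rotating the finger's node with its parent; an access to $x$ must make the finger touch the node of $x$. An online BST data structure chooses its operations using only the prefix of the access sequence up to the current access. Real-world: implementable with a constant number of $O(\log n)$-bit registers and $O(\log n)$ bits of augmented data per node. Well-behaved: for a data structure $A$ and initial tree $T$, $\tau_A(T,X)=\sum_{i=1}^{|X|}\tau_A(T,X,i)+f(n)$ is an upper bound on the total running time of $A$ on access sequence $X$ from $T$, where $\tau_A(T,X,i)$ is an amortized upper bound on the cost of the $i$th access and $f(n)$ is the overhead; for a contiguous subsequence $X'$ of $X$, $\tau_A(T,X,X')=\sum_{i=1}^{|X'|}\tau_A(T,X,\pi(i))$ with $\pi(i)$ the index in $X$ of the $i$th access of $X'$. $A$ is well-behaved with overhead $f(n)$ if there are constants $c'',d$ such that any single access costs at most $d\cdot f(n)$ and $\tau_A(T,X')\le c''\cdot \tau_A(T,X,X')+d\cdot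 f(n)$ for all $T$, $X$, and contiguous subsequences $X'$ of $X$.
   Formalization: ''Well-behaved'' is taken to mean well-behaved with overhead f(n) = O(n), both for the given structures and for D; with superlinear overhead the bound with additive term c'·n fails. *)

(* Defs.v *)
From HB Require Import structures.
From mathcomp Require Import all_boot all_order all_algebra.
From mathcomp Require Import reals.

Set Implicit Arguments.
Unset Strict Implicit.
Unset Printing Implicit Defensive.

Import Order.TTheory GRing.Theory Num.Theory.
Local Open Scope ring_scope.

Section Trees.
Variable K : Type.

Inductive btree := Leaf | Node of btree & K & btree.

Fixpoint inorder (t : btree) : seq K :=
  if t is Node l x r then inorder l ++ x :: inorder r else [::].

Definition is_node (t : btree) : bool := if t is Node _ _ _ then true else false.

Definition root_key (t : btree) : option K :=
  if t is Node _ x _ then Some x else None.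

(* [InLeft p s]: the subtree is the left child of the node [p], whose right
   subtree is [s]; [InRight s p] is the mirror image. *)
Inductive frame := InLeft of K & btree | InRight of btree & K.

(* A tree with a finger, as a zipper: the frames from the finger's node up to
   the root, and the subtree rooted at the finger's node. *)
Definition fingered : Type := (seq frame * btree)%type.

Definition finger_at_root (t : btree) : fingered := ([::], t).

Definition finger_key (z : fingered) : option K := root_key z.2.

Inductive bst_op := MoveLeft | MoveRight | MoveUp | Rotate.

(* [None] when the operation is impossible (missing child or parent).  After a
   rotation the finger stays on the node that has moved up. *)
Definition apply_op (z : fingered) (o : bst_op) : option fingered :=
  match o, z with
  | MoveLeft, (ctx, Node (Node _ _ _ as l) x r) => Some (InLeft x r :: ctx, l)
  | MoveRight, (ctx, Node l x (Node _ _ _ as r)) => Some (InRight l x :: ctx, r)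
  | MoveUp, (InLeft p s :: ctx, t) => Some (ctx, Node t p s)
  | MoveUp, (InRight s p :: ctx, t) => Some (ctx, Node s p t)
  | Rotate, (InLeft p s :: ctx, Node a x b) => Some (ctx, Node a x (Node b p s))
  | Rotate, (InRight s p :: ctx, Node a x b) => Some (ctx, Node (Node s p a) x b)
  | _, _ => None
  end.

Fixpoint apply_ops (z : fingered) (os : seq bst_op) : option fingered :=
  if os is o :: os' then obind (fun z' => apply_ops z' os') (apply_op z o)
  else Some z.

End Trees.

Arguments Leaf {K}.

(* The search trees storing exactly the keys 0 < 1 < ... < n-1. *)
Definition is_bst n (T : btree 'I_n) : Prop := inorder T = enum 'I_n.

(* A data structure is a family indexed by the number [n] of keys, so that
   "constant" means independent of [n].  [A n T p] is the list of operations
   performed for the last access of the nonempty prefix [p] of the access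
   sequence, the initial tree being [T]; seeing only [p] is what makes it
   online. *)
Definition bst_alg : Type :=
  forall n : nat, btree 'I_n -> seq 'I_n -> seq bst_op.

Section Algorithms.
Variables (A : bst_alg) (n : nat) (T : btree 'I_n) (X : seq 'I_n).

(* Accesses are numbered from 0. *)
Definition access_ops (i : nat) : seq bst_op := A T (take i.+1 X).

Definition access_cost (i : nat) : nat := size (access_ops i).

Definition total_cost : nat := (\sum_(0 <= i < size X) access_cost i)%N.

Definition before_access (i : nat) : option (fingered 'I_n) :=
  apply_ops (finger_at_root T) (flatten [seq access_ops j | j <- iota 0 i]).

End Algorithms.

Definition touches n (z : fingered 'I_n) (os : seq bst_op) (x : 'I_n) : Prop :=
  exists2 j, (j <= size os)%N &
    obind (@finger_key _) (apply_ops z (take j os)) = Some x.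

Definition online_bst (A : bst_alg) : Prop :=
  forall (n : nat) (T : btree 'I_n) (X : seq 'I_n) (x0 : 'I_n) (i : nat),
    is_bst T -> (i < size X)%N ->
    exists z z' : fingered 'I_n,
      [/\ before_access A T X i = Some z,
          apply_ops z (access_ops A T X i) = Some z' &
          touches z (access_ops A T X i) (nth x0 X i)].

Section Bounds.
Variable R : realType.

(* [tau n T X i]: amortized bound for access number [i] of [X], from [T]. *)
Definition access_bound : Type :=
  forall n : nat, btree 'I_n -> seq 'I_n -> nat -> R.

(* Sum of the bounds over the [m] accesses of [X] starting at number [s]. *)
Definition tau_sub (tau : access_bound) n (T : btree 'I_n) (X : seq 'I_n)
    (s m : nat) : R :=
  \sum_(s <= i < s + m) tau n T X i.

Definition tau_total (tau : access_bound) (f : nat -> R) n (T : btree 'I_n)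
    (X : seq 'I_n) : R :=
  tau_sub tau T X 0 (size X) + f n.

Definition well_behaved_with (A : bst_alg) (tau : access_bound)
    (f : nat -> R) : Prop :=
  (forall (n : nat) (T : btree 'I_n) (X : seq 'I_n), (0 < n)%N -> is_bst T ->
     (total_cost A T X)%:R <= tau_total tau f T X) /\
  exists c'' d : R,
    [/\ 0 < c'', 0 < d,
        forall (n : nat) (T : btree 'I_n) (X : seq 'I_n) (i : nat),
          (0 < n)%N -> is_bst T -> (i < size X)%N ->
          (access_cost A T X i)%:R <= d * f n &
        forall (n : nat) (T : btree 'I_n) (P X' S : seq 'I_n),
          (0 < n)%N -> is_bst T ->
          tau_total tau f T X' <=
            c'' * tau_sub tau T (P ++ X' ++ S) (size P) (size X') + d * f n].

(* The overhead is linear when not specified: this is what the additive term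
   c' * n of the combination theorem refers to, and that theorem fails for
   superlinear overheads. *)
Definition well_behaved (A : bst_alg) (tau : access_bound) : Prop :=
  exists f : nat -> R,
    (exists C : R, forall n : nat, (0 < n)%N -> f n <= C * n%:R) /\
    well_behaved_with A tau f.

End Bounds.

(* Bit strings of length b * (floor (log2 n) + 1). *)
Definition word (b n : nat) : predArgType :=
  (b * (trunc_log 2 n).+1).-tuple bool.

Record node_view (b n : nat) := NodeView {
  view_key : 'I_n;
  view_aug : word b n;
  view_has_left : bool;
  view_has_right : bool;
  view_has_parent : bool }.

(* [rw_step] maps the requested key, the registers and the finger's node to the
   new registers, the new augmented data of that node, and the next operation,
   or [None] if the current access is over. *)
Record rw_machine (b k : nat) := RwMachine {
  rw_reg0 : forall n, k.-tuple (word b n);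
  rw_aug0 : forall n, word b n;
  rw_step : forall n, 'I_n -> k.-tuple (word b n) -> node_view b n ->
    k.-tuple (word b n) * word b n * option bst_op }.

Section RealWorld.
Variables (b k : nat) (M : rw_machine b k) (n : nat).

(* Nodes are identified with their keys, so augmented data follows its node
   through rotations. *)
Record rw_state := RwState {
  st_regs : k.-tuple (word b n);
  st_aug : {ffun 'I_n -> word b n};
  st_tree : fingered 'I_n }.

Definition rw_init (T : btree 'I_n) : rw_state :=
  RwState (rw_reg0 M n) [ffun => rw_aug0 M n] (finger_at_root T).

Definition set_aug (a : {ffun 'I_n -> word b n}) (x : 'I_n) (w : word b n) :
    {ffun 'I_n -> word b n} :=
  [ffun y => if y == x then w else a y].

Definition rw_decide (y : 'I_n) (s : rw_state) :
    option (k.-tuple (word b n) * {ffun 'I_n -> word b n} * option bst_op) :=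
  if st_tree s is (ctx, Node l x r) then
    let v := NodeView x (st_aug s x) (is_node l) (is_node r) (0 < size ctx)%N in
    let: (regs, w, o) := rw_step M y (st_regs s) v in
    Some (regs, set_aug (st_aug s) x w, o)
  else None.

Inductive rw_access (y : 'I_n) : rw_state -> seq bst_op -> rw_state -> Prop :=
| RwDone s regs aug :
    rw_decide y s = Some (regs, aug, None) ->
    rw_access y s [::] (RwState regs aug (st_tree s))
| RwOp s regs aug o z os s' :
    rw_decide y s = Some (regs, aug, Some o) ->
    apply_op (st_tree s) o = Some z ->
    rw_access y (RwState regs aug z) os s' ->
    rw_access y s (o :: os) s'.

Inductive rw_run : rw_state -> seq 'I_n -> seq (seq bst_op) -> rw_state -> Prop :=
| RwNil s : rw_run s [::] [::] s
| RwCons s y os s' X oss s'' :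
    rw_access y s os s' -> rw_run s' X oss s'' ->
    rw_run s (y :: X) (os :: oss) s''.

End RealWorld.

Definition real_world (A : bst_alg) : Prop :=
  exists (b k : nat) (M : rw_machine b k),
    forall (n : nat) (T : btree 'I_n) (X : seq 'I_n), (0 < n)%N -> is_bst T ->
      exists s : rw_state b k n,
        rw_run M (rw_init M T) X
          [seq access_ops A T X i | i <- iota 0 (size X)] s.

(* Main.v *)
From HB Require Import structures.
Require Import Defs.
From mathcomp Require Import all_boot all_order all_algebra.
From mathcomp Require Import reals boolp lra zify.

Set Implicit Arguments.
Unset Strict Implicit.
Unset Printing Implicit Defensive.

Import Order.TTheory GRing.Theory Num.Theory.

(** The combined structure works in phases.  Each phase restores the initial tree
    [T], in O(n) operations, and then simulates [A0] or [A1] in alternation from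
    [T], until the simulated structure has spent [K * n] operations.

    For the analysis, call an access sequence good when the bounds of both
    structures, started afresh from [T], are at least [L * n] on it, and let [N X]
    be the largest number of disjoint contiguous good pieces of [X].  Two
    consecutive complete phases form a good piece, so the cost on [X] is
    O(n * (N X + 1)).  Well-behavedness of [A0] and [A1] gives
    [n * N Z <= tau(Z) + O(n)] for either of their bounds.  Since
    [N U + N V <= N (U ++ V) <= N U + N V + 1], the increments of a constant times
    [n * N] along the prefixes of [X] are an amortized bound with all the required
    properties; the actual costs are not, as their sum over a piece of [X] depends
    on how the phases happen to be aligned with it.

    To restore [T] with logarithmic memory, the current tree is rotated into a
    right vine, and [T] is rebuilt from the vine in symmetric order: each node [x]
    is rotated upwards as many times as the right spine of its left subtree in [T]
    has nodes.  This number is kept at [x]; it is found during the first reset,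
    since rotating [T] into a vine performs exactly these rotations backwards. *)

(** * Rebuilding a tree through a vine *)

Section TreeSurgery.
Variable K : Type.
Implicit Types (t l r S T V : btree K) (ctx : seq (frame K)) (z : fingered K).

Definition plug (f : frame K) t : btree K :=
  match f with InLeft p s => Node t p s | InRight s p => Node s p t end.

Definition whole z : btree K := foldl (fun t f => plug f t) z.2 z.1.

Lemma inorder_foldl_plug ctx t1 t2 : inorder t1 = inorder t2 ->
  inorder (foldl (fun t f => plug f t) t1 ctx) =
  inorder (foldl (fun t f => plug f t) t2 ctx).
Proof.
elim: ctx t1 t2 => //= f ctx IH t1 t2 e; apply: IH.
by case: f => /= *; rewrite e.
Qed.

Lemma apply_op_inorder z o z' :
  apply_op z o = Some z' -> inorder (whole z') = inorder (whole z).
Proof.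
case: z => ctx t; case: o => /=.
- by case: t => [|[|a y b] x r] //= [<-].
- by case: t => [|l x [|a y b]] //= [<-].
- by case: ctx => [|[p s|s p] ctx] //= [<-].
- case: ctx => [|[p s|s p] ctx] //; case: t => [|a x b] //= [<-];
    by apply: inorder_foldl_plug; rewrite /= -catA.
Qed.

Lemma apply_op_is_node z o z' : apply_op z o = Some z' -> is_node z'.2.
Proof.
case: z => ctx t; case: o => /=.
- by case: t => [|[|a y b] x r] //= [<-].
- by case: t => [|l x [|a y b]] //= [<-].
- by case: ctx => [|[p s|s p] ctx] //= [<-].
- by case: ctx => [|[p s|s p] ctx] //; case: t => [|a x b] //= [<-].
Qed.

Lemma apply_ops_cat z os1 os2 :
  apply_ops z (os1 ++ os2) = obind (fun z' => apply_ops z' os2) (apply_ops z os1).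
Proof. by elim: os1 z => //= o os IH z; case: (apply_op z o). Qed.

Lemma apply_ops_inorder z os z' :
  apply_ops z os = Some z' -> inorder (whole z') = inorder (whole z).
Proof.
elim: os z => [z [->] //|o os IH z /=].
by case e: (apply_op z o) => [z1|//] /= /IH ->; apply: apply_op_inorder e.
Qed.

Lemma apply_ops_is_node z os z' :
  apply_ops z os = Some z' -> is_node z.2 -> is_node z'.2.
Proof.
elim: os z => [z [->] //|o os IH z /=].
case e: (apply_op z o) => [z1|//] /= /IH + _; apply; exact: apply_op_is_node e.
Qed.

Lemma apply_ops_move_up ctx t :
  apply_ops (ctx, t) (nseq (size ctx) MoveUp) = Some ([::], whole (ctx, t)).
Proof. by elim: ctx t => //= [[p s|s p]] ctx IH t /=; rewrite IH. Qed.

Lemma size_inorder_plug f t :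
  (size (inorder t) < size (inorder (plug f t)))%N.
Proof. by case: f => p s /=; rewrite size_cat /=; lia. Qed.

Lemma size_context_whole ctx t :
  (size ctx + size (inorder t) <= size (inorder (whole (ctx, t))))%N.
Proof.
rewrite /whole /=; elim: ctx t => //= f ctx IH t.
by have := IH (plug f t); have := size_inorder_plug f t; lia.
Qed.

Lemma whole_is_node ctx t : is_node t -> is_node (whole (ctx, t)).
Proof.
rewrite /whole /=; elim: ctx t => //= f ctx IH t _; apply: IH; by case: f.
Qed.

Definition vine (s : seq K) V : btree K := foldr (fun x v => Node Leaf x v) V s.

Lemma vine_cat s1 x s2 V :
  vine (s1 ++ x :: s2) V = vine s1 (Node Leaf x (vine s2 V)).
Proof. exact: foldr_cat. Qed.

Lemma apply_move_right ctx l x r os : is_node r ->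
  apply_ops (ctx, Node l x r) (MoveRight :: os) =
  apply_ops (InRight l x :: ctx, r) os.
Proof. by case: r. Qed.

Lemma vine_is_node s V : is_node V -> is_node (vine s V).
Proof. by case: s. Qed.

Fixpoint spine_size t : nat := if t is Node _ _ r then (spine_size r).+1 else 0%N.

(** The context, innermost frame first, of the leaf that ends the right spine of [t]. It is also
    what exposing a node with left subtree [t] leaves above that node. *)
Fixpoint spine t : seq (frame K) :=
  if t is Node l x r then spine r ++ [:: InRight l x] else [::].

(* Rotates the right spine of the left subtree [l] of the finger's node above
   that node, from the top down. *)
Fixpoint expose_ops l : seq bst_op :=
  if l is Node _ _ b then [:: MoveLeft; Rotate; MoveRight] ++ expose_ops b
  else [::].

(** Meant for a finger on a node hanging at the end of the right spine of [S]: the spine is treated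
    bottom up, and exposing one of its nodes puts a new right spine above that node, which is
    treated in turn. *)
Fixpoint unbuild_ops S : seq bst_op :=
  if S is Node l x r then
    unbuild_ops r ++ [:: MoveUp] ++ expose_ops l ++ unbuild_ops l
  else [::].

(** Here the finger starts at the root of [S] and no node hangs below the right spine, so it has to
    descend to the last node, which is not re-entered by a [MoveUp]. *)
Fixpoint flatten_ops S : seq bst_op :=
  if S is Node l x r then
    (if r is Leaf then [::] else MoveRight :: flatten_ops r ++ [:: MoveUp])
      ++ expose_ops l ++ unbuild_ops l
  else [::].

(** Consumes the keys of [T] from the top of a vine. When the finger is at [x], the left subtree of
    [x] is already assembled but lies along the path above [x]; the rotations bring it below. *)
Fixpoint build_ops T : seq bst_op :=
  if T is Node l x r then
    build_ops l ++ nseq (spine_size l) Rotate ++ [:: MoveRight] ++ build_ops r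
  else [::].

(** For a vine that ends with the keys of [T]: there is no next node to move to, and the finger
    returns to the root. *)
Fixpoint restore_ops T : seq bst_op :=
  if T is Node l x r then
    build_ops l ++ nseq (spine_size l) Rotate ++
      (if r is Leaf then [::] else MoveRight :: restore_ops r ++ [:: MoveUp])
  else [::].

Definition reset_ops z T : seq bst_op :=
  nseq (size z.1) MoveUp ++ flatten_ops (whole z) ++ restore_ops T.

Lemma apply_expose_ops ctx l x r :
  apply_ops (ctx, Node l x r) (expose_ops l) = Some (spine l ++ ctx, Node Leaf x r).
Proof. by elim: l ctx => //= a _ p b IH ctx; rewrite IH -catA. Qed.

Lemma apply_unbuild_ops ctx S V : is_node V ->
  apply_ops (spine S ++ ctx, V) (unbuild_ops S) = Some (ctx, vine (inorder S) V).
Proof.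
elim: S ctx V => //= l IHl x r IHr ctx V nV.
rewrite -catA apply_ops_cat IHr //= apply_ops_cat apply_expose_ops /=.
by rewrite IHl // /vine foldr_cat.
Qed.

Lemma apply_flatten_ops ctx S : is_node S ->
  apply_ops (ctx, S) (flatten_ops S) = Some (ctx, vine (inorder S) Leaf).
Proof.
elim: S ctx => //= l _ x r IHr ctx _.
have E V : apply_ops (ctx, Node l x V) (expose_ops l ++ unbuild_ops l) =
    Some (ctx, vine (inorder l) (Node Leaf x V)).
  by rewrite apply_ops_cat apply_expose_ops /= apply_unbuild_ops.
rewrite apply_ops_cat /vine foldr_cat -!/(vine _ _).
case: r IHr => [|a y b] IHr; first exact: E.
have -> : apply_ops (ctx, Node l x (Node a y b))
    (MoveRight :: flatten_ops (Node a y b) ++ [:: MoveUp]) =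
    Some (ctx, Node l x (vine (inorder (Node a y b)) Leaf)).
  have := IHr (InRight l x :: ctx) isT.
  by move: (flatten_ops _) (vine _ _) => F v e; rewrite /= apply_ops_cat e.
exact: E.
Qed.

Lemma apply_rotate_spine ctx l a x V :
  apply_ops (spine l ++ ctx, Node a x V) (nseq (spine_size l) Rotate) =
  Some (ctx, Node (foldl (fun t f => plug f t) a (spine l)) x V).
Proof.
elim: l ctx a => [//|s _ p b IH] ctx a.
rewrite [spine _]/= [spine_size _]/= -addn1 nseqD.
by rewrite -catA apply_ops_cat IH /= foldl_cat.
Qed.

Lemma whole_spine l : whole (spine l, Leaf) = l.
Proof.
by rewrite /whole; elim: l => //= l _ x r IH; rewrite foldl_cat IH.
Qed.

Lemma apply_climb_ops ctx l x V :
  apply_ops (spine l ++ ctx, Node Leaf x V) (nseq (spine_size l) Rotate) =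
  Some (ctx, Node l x V).
Proof. by rewrite apply_rotate_spine -/(whole (_, _)) whole_spine. Qed.

Lemma apply_build_ops ctx T V : is_node V ->
  apply_ops (ctx, vine (inorder T) V) (build_ops T) = Some (spine T ++ ctx, V).
Proof.
elim: T ctx V => // l IHl x r IHr ctx V nV.
rewrite [inorder _]/= vine_cat [build_ops _]/= apply_ops_cat IHl // [LHS]/=.
rewrite apply_ops_cat apply_climb_ops.
transitivity (apply_ops (ctx, Node l x (vine (inorder r) V))
                        (MoveRight :: build_ops r)) => //.
by rewrite apply_move_right ?vine_is_node // IHr // -catA.
Qed.

Lemma apply_restore_ops ctx T : is_node T ->
  apply_ops (ctx, vine (inorder T) Leaf) (restore_ops T) = Some (ctx, T).
Proof.
elim: T ctx => // l _ x r IHr ctx _.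
rewrite [inorder _]/= vine_cat [restore_ops _]/= !apply_ops_cat.
rewrite apply_build_ops // [LHS]/= apply_ops_cat apply_climb_ops.
case: r IHr => [//|a y b] IHr.
have := IHr (InRight l x :: ctx) isT.
have : is_node (vine (inorder (Node a y b)) Leaf) by rewrite /= vine_cat vine_is_node.
move: (restore_ops _) (vine _ _) => F v nv e.
transitivity (apply_ops (ctx, Node l x v) (MoveRight :: F ++ [:: MoveUp])) => //.
by rewrite apply_move_right // apply_ops_cat e.
Qed.

Lemma apply_reset_ops z T : is_node z.2 -> is_node T ->
  inorder (whole z) = inorder T -> apply_ops z (reset_ops z T) = Some ([::], T).
Proof.
case: z => ctx t nt nT e; rewrite /reset_ops !apply_ops_cat apply_ops_move_up /=.
by rewrite apply_ops_cat apply_flatten_ops ?whole_is_node //= e apply_restore_ops.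
Qed.

Lemma size_expose_ops l : size (expose_ops l) = (3 * spine_size l)%N.
Proof. by elim: l => //= _ _ _ b ->; lia. Qed.

(** Each node costs one [MoveUp], and three operations to be brought onto the spine; the latter are
    saved for the nodes that are on the right spine of [S] from the start. *)
Lemma size_unbuild_ops S :
  (size (unbuild_ops S) + 3 * spine_size S = 4 * size (inorder S))%N.
Proof. by elim: S => //= l IHl x r IHr; rewrite !size_cat /= !size_cat size_expose_ops; lia. Qed.

Lemma size_flatten_ops S : (size (flatten_ops S) <= 4 * size (inorder S))%N.
Proof.
elim: S => //= l _ x r IHr; rewrite !size_cat size_expose_ops /=.
have := size_unbuild_ops l; case: r IHr => [|a y b] IHr; first by rewrite /=; lia.
by rewrite [size (_ :: _)]/= size_cat /=; move: IHr; rewrite /=; lia.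
Qed.

(** Each node is left by one [MoveRight] and later passed by one rotation, except that the nodes of
    the right spine of [T] are never passed. *)
Lemma size_build_ops T : (size (build_ops T) + spine_size T = 2 * size (inorder T))%N.
Proof. by elim: T => //= l IHl x r IHr; rewrite !size_cat /= size_nseq; lia. Qed.

Lemma size_restore_ops T : (size (restore_ops T) <= 2 * size (inorder T))%N.
Proof.
elim: T => //= l _ x r IHr; rewrite !size_cat size_nseq /=.
have := size_build_ops l; case: r IHr => [|a y b] IHr; first by rewrite /=; lia.
by rewrite [size (_ :: _)]/= size_cat /=; move: IHr; rewrite /=; lia.
Qed.

Lemma size_reset_ops z T : inorder (whole z) = inorder T ->
  (size (reset_ops z T) <= 7 * size (inorder T))%N.
Proof.
case: z => ctx t e; rewrite /reset_ops !size_cat size_nseq /=.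
have := size_context_whole ctx t; have := size_restore_ops T.
by have := size_flatten_ops (whole (ctx, t)); rewrite e; lia.
Qed.

Lemma spine_size_le l : (spine_size l <= size (inorder l))%N.
Proof. by elim: l => //= l _ x r; rewrite size_cat /=; lia. Qed.

End TreeSurgery.

(** * Packing and the combined algorithm *)

Section Packing.
Variables (U : Type) (good : seq U -> Prop).
Implicit Types X Y Z P S : seq U.

(** Pieces are peeled off from the right. Being nonempty, they are at most [size X] in number, so
    that a maximum exists. *)
Fixpoint packs k X : Prop :=
  if k is k'.+1 then
    exists P Z S, [/\ X = P ++ Z ++ S, (0 < size Z)%N, good Z & packs k' P]
  else True.

Lemma packs_size k X : packs k X -> (k <= size X)%N.
Proof.
elim: k X => //= k IH X [P [Z [S [-> Z0 _ /IH]]]]; rewrite !size_cat; lia.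
Qed.

Lemma packs_catr k X Y : packs k X -> packs k (X ++ Y).
Proof.
case: k => //= k [P [Z [S [-> Z0 gZ pP]]]].
by exists P, Z, (S ++ Y); rewrite -!catA.
Qed.

Lemma packs_cat j k X Y : packs j X -> packs k Y -> packs (j + k) (X ++ Y).
Proof.
move=> pX; elim: k Y => [|k IH] Y /=; first by rewrite addn0 => _; apply: packs_catr.
move=> [P [Z [S [-> Z0 gZ /IH pP]]]]; rewrite addnS.
by exists (X ++ P), Z, S; rewrite -!catA.
Qed.

(** Disjoint pieces: only one of them can straddle the cut, and it is the one lost. *)
Lemma packs_split k X Y : packs k (X ++ Y) ->
  exists i j, [/\ packs i X, packs j Y & (k <= i + j + 1)%N].
Proof.
elim: k X Y => [|k IH] X Y /=; first by exists 0%N, 0%N.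
move=> [P [Z [S [e Z0 gZ pP]]]].
(* Either the last piece lies within [Y], and the induction applies to what precedes it, or it
   starts inside [X], and all the others lie in [X]. *)
have [le_XP|lt_PX] := leqP (size X) (size P).
  have eP : P = X ++ drop (size X) P.
    rewrite -{1}(cat_take_drop (size X) P); congr (_ ++ _).
    by move/(congr1 (take (size X))): e; rewrite take_size_cat // takel_cat.
  have eY : Y = drop (size X) P ++ Z ++ S.
    move/(congr1 (drop (size X))): e; rewrite drop_size_cat //.
    by rewrite {1}eP -catA drop_size_cat.
  move: pP; rewrite eP => /IH[i [j [pX pP' le_k]]].
  exists i, j.+1; split=> //; last by lia.
  by exists (drop (size X) P), Z, S.
exists k, 0%N; split=> //; last by lia.
have -> : X = P ++ drop (size P) X.
  rewrite -{1}(cat_take_drop (size P) X); congr (_ ++ _).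
  move/(congr1 (take (size P))): e.
  by rewrite takel_cat 1?ltnW // take_size_cat.
exact: packs_catr.
Qed.

Lemma packs_exists X : exists k, `[<packs k X>].
Proof. by exists 0%N; apply/asboolP. Qed.

Lemma packs_bounded X k : `[<packs k X>] -> (k <= size X)%N.
Proof. by move/asboolP/packs_size. Qed.

Definition npack X : nat := ex_maxn (packs_exists X) (@packs_bounded X).

Lemma packs_npack X : packs (npack X) X.
Proof. by rewrite /npack; case: ex_maxnP => k /asboolP. Qed.

Lemma packs_le_npack k X : packs k X -> (k <= npack X)%N.
Proof. by move=> p; rewrite /npack; case: ex_maxnP => i _; apply; apply/asboolP. Qed.

Lemma npack0 : npack [::] = 0%N.
Proof. by have := packs_size (packs_npack [::]) => /=; lia. Qed.

Lemma leq_npack_cat X Y : (npack X + npack Y <= npack (X ++ Y))%N.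
Proof. by apply: packs_le_npack; apply: packs_cat; apply: packs_npack. Qed.

Lemma npack_cat_leq X Y : (npack (X ++ Y) <= npack X + npack Y + 1)%N.
Proof.
have [i [j [/packs_le_npack pX /packs_le_npack pY]]] := packs_split (packs_npack (X ++ Y)).
lia.
Qed.

End Packing.

(** * Runs of a data structure, extended by one access at a time *)

Lemma size_inorder_bst n (T : btree 'I_n) : is_bst T -> size (inorder T) = n.
Proof. by move=> ->; rewrite size_enum_ord. Qed.

Lemma is_node_bst n (T : btree 'I_n) : (0 < n)%N -> is_bst T -> is_node T.
Proof. by move=> n0 /size_inorder_bst; case: T => //= e; rewrite -e in n0. Qed.

Section Runs.
Variables (A : bst_alg) (n : nat) (T : btree 'I_n).

Definition access_list (X : seq 'I_n) : seq (seq bst_op) :=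
  [seq access_ops A T X i | i <- iota 0 (size X)].

Lemma access_list_rcons X y :
  access_list (rcons X y) = rcons (access_list X) (A T (rcons X y)).
Proof.
rewrite /access_list size_rcons -addn1 iotaD map_cat cats1 add0n /=.
rewrite /access_ops take_oversize ?size_rcons //; congr rcons.
apply/eq_in_map => i; rewrite mem_iota add0n => /= lt_i.
by rewrite -cats1 takel_cat.
Qed.

Lemma access_list_take X i : (i <= size X)%N ->
  [seq access_ops A T X j | j <- iota 0 i] = access_list (take i X).
Proof.
move=> le_i; rewrite /access_list size_takel //.
apply/eq_in_map => j; rewrite mem_iota add0n => /= lt_j.
by rewrite /access_ops take_takel.
Qed.

Lemma total_cost_sumn X : total_cost A T X = sumn [seq size os | os <- access_list X].
Proof. by rewrite /total_cost sumnE !big_map /index_iota subn0. Qed.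

Lemma total_cost_rcons X y :
  total_cost A T (rcons X y) = (total_cost A T X + size (A T (rcons X y)))%N.
Proof. by rewrite !total_cost_sumn access_list_rcons map_rcons sumn_rcons. Qed.

Definition run (X : seq 'I_n) : option (fingered 'I_n) :=
  apply_ops (finger_at_root T) (flatten (access_list X)).

Lemma run_rcons X y :
  run (rcons X y) = obind (fun z => apply_ops z (A T (rcons X y))) (run X).
Proof. by rewrite /run access_list_rcons flatten_rcons apply_ops_cat. Qed.

End Runs.

Lemma online_bstP (A : bst_alg) : online_bst A <->
  forall n (T : btree 'I_n) X y, is_bst T ->
  exists z z', [/\ run A T X = Some z, apply_ops z (A n T (rcons X y)) = Some z' &
                   touches z (A n T (rcons X y)) y].
Proof.
split=> [on n T X y bT|on n T X x0 i bT lt_i].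
  have [|z [z' [e1 e2 e3]]] := on n T (rcons X y) y (size X) bT.
    by rewrite size_rcons.
  move: e1 e2 e3; rewrite /before_access access_list_take ?size_rcons //.
  rewrite -cats1 take_size_cat // cats1 nth_rcons ltnn eqxx.
  rewrite /access_ops take_oversize ?size_rcons //.
  by move=> e1 e2 e3; exists z, z'.
have [z [z' [e1 e2 e3]]] := on n T (take i X) (nth x0 X i) bT.
exists z, z'; rewrite /before_access access_list_take 1?ltnW //.
by rewrite /access_ops (take_nth x0).
Qed.

(** * The algorithm that alternates between two structures *)

Section Combination.
Variables (A : bool -> bst_alg) (K : nat).

(* [(a, Y, z)]: [A a] is being simulated from the initial tree, [Y] are the
   accesses of the current phase and [z] is the current tree. *)
Definition comb_state n : Type := (bool * seq 'I_n * fingered 'I_n)%type.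

Definition comb_ops n (T : btree 'I_n) (s : comb_state n) (y : 'I_n) : seq bst_op :=
  let: (a, Y, z) := s in
  (if Y is [::] then reset_ops z T else [::]) ++ A a T (rcons Y y).

Definition comb_next n (T : btree 'I_n) (s : comb_state n) (y : 'I_n) :
    comb_state n :=
  let: (a, Y, z) := s in
  (* By [comb_next_spec] the operations are possible in all states that occur, so the default is
     never taken. *)
  let z' := odflt z (apply_ops z (comb_ops T s y)) in
  if (K * n <= total_cost (A a) T (rcons Y y))%N then (~~ a, [::], z')
  else (a, rcons Y y, z').

Definition comb_run n (T : btree 'I_n) (p : seq 'I_n) : comb_state n :=
  foldl (comb_next T) (false, [::], finger_at_root T) p.

(** The state is recomputed from the prefix alone, which keeps the algorithm online. *)
Definition combination : bst_alg := fun n T p =>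
  if rev p is y :: q then comb_ops T (comb_run T (rev q)) y else [::].

Lemma combination_rcons n (T : btree 'I_n) p y :
  combination T (rcons p y) = comb_ops T (comb_run T p) y.
Proof. by rewrite /combination rev_rcons revK. Qed.

Lemma comb_run_rcons n (T : btree 'I_n) p y :
  comb_run T (rcons p y) = comb_next T (comb_run T p) y.
Proof. exact: foldl_rcons. Qed.

(** The reset is done by the first access of a phase. So between phases the tree may have any shape,
    while within a phase it is the one that the simulated structure would have reached from [T] by
    itself. *)
Definition comb_inv n (T : btree 'I_n) (s : comb_state n) : Prop :=
  [/\ is_node s.2.2, inorder (whole s.2) = inorder T &
      (0 < size s.1.2)%N -> run (A s.1.1) T s.1.2 = Some s.2].

Hypothesis online_A : forall a, online_bst (A a).

Lemma comb_next_spec n (T : btree 'I_n) s y : is_bst T -> comb_inv T s ->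
  [/\ apply_ops s.2 (comb_ops T s y) = Some (comb_next T s y).2,
      touches s.2 (comb_ops T s y) y & comb_inv T (comb_next T s y)].
Proof.
case: s => [[a Y] z] bT [/= nz ez rz].
have nT : is_node T by apply: is_node_bst bT; apply: leq_ltn_trans (ltn_ord y).
have [z1 [z2 [e1 e2 [j le_j ej]]]] := (online_bstP (A a)).1 (online_A a) n T Y y bT.
set pre := if Y is [::] then reset_ops z T else [::].
have epre : apply_ops z pre = Some z1.
  rewrite /pre; case: Y e1 rz {pre e2 le_j ej} => [|x Y] e1 rz.
    by rewrite apply_reset_ops // -e1.
  by rewrite -e1 rz.
have eall : apply_ops z (pre ++ A a T (rcons Y y)) = Some z2.
  by rewrite apply_ops_cat epre.
have inv2 : is_node z2.2 /\ inorder (whole z2) = inorder T.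
  by rewrite (apply_ops_inorder eall) (apply_ops_is_node eall).
rewrite -/pre eall /=; split.
- by case: ifP.
- exists (size pre + j)%N; first by rewrite size_cat leq_add2l.
  by rewrite takeD take_size_cat // drop_size_cat // apply_ops_cat epre.
- case: ifP => _; split; rewrite ?inv2.1 ?inv2.2 //=.
  by rewrite run_rcons e1 /=.
Qed.

Lemma comb_inv_run n (T : btree 'I_n) p : (0 < n)%N -> is_bst T ->
  comb_inv T (comb_run T p).
Proof.
move=> n0 bT; elim/last_ind: p => [|p y IH].
  by split=> //=; apply: is_node_bst bT.
by rewrite comb_run_rcons; have [] := comb_next_spec y bT IH.
Qed.

Lemma run_combination n (T : btree 'I_n) p : (0 < n)%N -> is_bst T ->
  run combination T p = Some (comb_run T p).2.
Proof.
move=> n0 bT; elim/last_ind: p => [//|p y IH].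
rewrite run_rcons IH /= combination_rcons comb_run_rcons.
by have [] := comb_next_spec y bT (comb_inv_run p n0 bT).
Qed.

Lemma online_combination : online_bst combination.
Proof.
apply/online_bstP => n T X y bT.
have n0 : (0 < n)%N by apply: leq_ltn_trans (ltn_ord y).
have [e1 e2 _] := comb_next_spec y bT (comb_inv_run X n0 bT).
exists (comb_run T X).2, (comb_next T (comb_run T X) y).2.
by rewrite run_combination // combination_rcons.
Qed.

Variable E : nat.
Hypothesis access_le : forall a n (T : btree 'I_n) X y, is_bst T ->
  (size (A a T (rcons X y)) <= E * n)%N.

Lemma size_comb_ops n (T : btree 'I_n) s y : is_bst T -> comb_inv T s ->
  (size (comb_ops T s y) <=
     (if s.1.2 is [::] then 7 * n else 0) + size (A s.1.1 T (rcons s.1.2 y)))%N.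
Proof.
case: s => [[a Y] z] bT [/= _ ez _]; rewrite size_cat leq_add2r.
case: Y => //; rewrite -[X in (_ <= _ * X)%N](size_inorder_bst bT).
exact: size_reset_ops.
Qed.

Lemma size_combination n (T : btree 'I_n) X y : is_bst T ->
  (size (combination T (rcons X y)) <= (7 + E) * n)%N.
Proof.
move=> bT; have n0 : (0 < n)%N by apply: leq_ltn_trans (ltn_ord y).
have := size_comb_ops y bT (comb_inv_run X n0 bT); rewrite combination_rcons.
have := access_le (comb_run T X).1.1 (comb_run T X).1.2 y bT.
by case: (comb_run T X).1.2 => [|? ?]; lia.
Qed.

(** * Cost of the alternating algorithm in terms of good pieces *)

Section Cost.
Variables (n : nat) (T : btree 'I_n) (good : seq 'I_n -> Prop).
Hypothesis bT : is_bst T.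
Hypothesis n_gt0 : (0 < n)%N.
Hypothesis good_pair : forall G Y,
  (K * n <= total_cost (A false) T G)%N -> (K * n <= total_cost (A true) T Y)%N ->
  good (G ++ Y).

(* [W] consists of [k] completed pairs of phases, each of which is a good piece,
   and [G] is the completed phase of [A false] when the current one simulates
   [A true]. *)
Definition comb_credit (p : seq 'I_n) (s : comb_state n) : Prop :=
  let: (a, Y, z) := s in
  exists W G k, [/\ p = W ++ G ++ Y, packs good k W,
    if a then (K * n <= total_cost (A false) T G)%N else G == [::] &
    (total_cost combination T p <= (k.*2 + a) * ((7 + K + E) * n) +
       (if Y is [::] then 0 else 7 * n) + total_cost (A a) T Y)%N
    /\ (Y <> [::] -> total_cost (A a) T Y < K * n)%N].

(** A completed phase costs at most [(7 + K + E) * n]: [7 * n] for the reset, [K * n] for the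
    accesses before the last, which stay below the threshold, and [E * n] for the last. *)
Lemma comb_credit_run p : (0 < K)%N -> comb_credit p (comb_run T p).
Proof.
move=> K0; elim/last_ind: p => [|p y IH].
  exists [::], [::], 0%N; split=> //.
  by rewrite /= !total_cost_sumn.
have inv := comb_inv_run p n_gt0 bT.
have := size_comb_ops y bT inv.
rewrite comb_run_rcons /comb_credit total_cost_rcons combination_rcons.
move: (size (comb_ops _ _ _)) => c.
case: (comb_run T p) IH inv => [[a Y] z] /= [W [G [k [ep pW HG [Hc HY]]]]] inv Hs.
have Ha := access_le a Y y bT.
have tc := total_cost_rcons (A a) T Y y.
have Hc' : (total_cost combination T p + c <=
   (k.*2 + a) * ((7 + K + E) * n) + 7 * n + total_cost (A a) T (rcons Y y))%N.
  rewrite tc; case: Y Hc Hs {HY inv ep Ha tc} => [|x Y]; lia.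
have tY : (total_cost (A a) T Y < K * n)%N.
  by case: Y HY {Hc Hs Ha tc Hc' ep inv} => [|x Y]; [rewrite total_cost_sumn /=; lia | apply].
case: ifP => [le_K|/negbT]; last first.
  rewrite -ltnNge => lt_K; exists W, G, k; split=> //.
  - by rewrite ep -!cats1 -!catA.
  - by split=> //; case: (Y) Hc'.
have phase : (total_cost (A a) T (rcons Y y) <= K * n + E * n)%N by lia.
case: a {HY Hs Ha tc tY inv} HG Hc Hc' le_K phase => HG Hc Hc' le_K phase /=.
  exists (W ++ G ++ rcons Y y), [::], k.+1; split=> //.
  - by rewrite ep -!cats1 -!catA.
  - exists W, (G ++ rcons Y y), [::]; split=> //; rewrite ?cats0 //.
      by rewrite size_cat size_rcons addnS.
    exact: good_pair.
  - by split=> //; rewrite [total_cost _ _ [::]]total_cost_sumn /=; lia.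
exists W, (rcons Y y), k; split=> //.
- by rewrite ep (eqP HG) -!cats1 -!catA.
- by split=> //; rewrite [total_cost _ _ [::]]total_cost_sumn /=; lia.
Qed.

(** With [k] completed pairs there are at most [2 * k + 1] completed phases and one current phase,
    hence the factor [2 * (k + 1)]. *)
Lemma total_cost_combination p : (0 < K)%N ->
  (total_cost combination T p <=
     2 * ((7 + K + E) * n) * (npack good p).+1)%N.
Proof.
move=> K0; have := comb_credit_run p K0.
case: (comb_run T p) => [[a Y] z] [W [G [k [-> pW _ [Hc HY]]]]].
have le_k : (k <= npack good (W ++ G ++ Y))%N.
  by apply: packs_le_npack; apply: packs_catr.
have tY : (total_cost (A a) T Y <= K * n)%N.
  case: Y HY {Hc le_k} => [|x Y] HY; first by rewrite total_cost_sumn.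
  by apply: ltnW; apply: HY.
have b7 : ((if Y is [::] then 0 else 7 * n) <= 7 * n)%N by case: (Y).
apply: leq_trans Hc _.
have : ((k.*2 + a) * ((7 + K + E) * n) <=
        ((npack good (W ++ G ++ Y)).*2 + 1) * ((7 + K + E) * n))%N.
  by rewrite leq_mul2r; apply/orP; right; case: (a); lia.
lia.
Qed.

End Cost.
End Combination.

(** * Amortized bounds *)

Section Bounds.
Local Open Scope ring_scope.
Variable R : realType.

Lemma tau_sub_cat (tau : access_bound R) n (T : btree 'I_n) X s m1 m2 :
  tau_sub tau T X s (m1 + m2) = tau_sub tau T X s m1 + tau_sub tau T X (s + m1) m2.
Proof. by rewrite /tau_sub addnA (big_cat_nat _ (n := s + m1)) ?leq_addr. Qed.

(** The form in which well-behavedness is used: the terms [d * f n] are replaced by [e * n] for one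
    natural number [e]. *)
Record linearly_behaved (A : bst_alg) (tau : access_bound R) (f : nat -> R)
    (c : R) (e : nat) : Prop := LinearlyBehaved {
  lb_pos : 0 < c;
  lb_overhead : forall n (T : btree 'I_n), (0 < n)%N -> is_bst T -> 0 <= f n;
  lb_total : forall n (T : btree 'I_n) X, (0 < n)%N -> is_bst T ->
    (total_cost A T X)%:R <= tau_total tau f T X;
  lb_access : forall n (T : btree 'I_n) X y, is_bst T ->
    (size (A n T (rcons X y)) <= e * n)%N;
  lb_sub : forall n (T : btree 'I_n) P X' S, (0 < n)%N -> is_bst T ->
    tau_total tau f T X' <=
      c * tau_sub tau T (P ++ X' ++ S) (size P) (size X') + e%:R * n%:R }.

Lemma well_behaved_linearly A tau : well_behaved A tau ->
  exists f c e, linearly_behaved A tau f c e.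
Proof.
move=> [f [[C fC] [tot [c [d [c0 d0 acc sub]]]]]].
have dfe n : (0 < n)%N -> d * f n <= (Num.bound `|d * C|)%:R * n%:R.
  move=> n0; apply: le_trans (_ : (d * C) * n%:R <= _).
    by rewrite -mulrA ler_pM2l // fC.
  rewrite ler_wpM2r // (le_trans (ler_norm _)) //.
  by rewrite ltW // archi_boundP.
exists f, c, (Num.bound `|d * C|); split=> //.
(* The cost of any one access, which is nonnegative, is bounded by [d * f n]. *)
- move=> n T n0 bT; rewrite -(pmulr_rge0 _ d0).
  by apply: le_trans (acc n T [:: Ordinal n0] 0%N n0 bT isT).
- move=> n T X y bT; have n0 : (0 < n)%N by apply: leq_ltn_trans (ltn_ord y).
  rewrite -(ler_nat R) natrM; apply: le_trans (dfe n n0).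
  have := acc n T (rcons X y) (size X) n0 bT.
  rewrite size_rcons /access_cost /access_ops take_oversize ?size_rcons //.
  exact.
- move=> n T P X' S n0 bT; apply: le_trans (sub n T P X' S n0 bT) _.
  by rewrite lerD2l dfe.
Qed.

(** * Lower estimates for the bounds of one structure *)

Section OneStructure.
Variables (A : bst_alg) (tau : access_bound R) (f : nat -> R) (c : R) (e : nat).
Hypothesis lb : linearly_behaved A tau f c e.
Variables (n : nat) (T : btree 'I_n).
Hypotheses (n_gt0 : (0 < n)%N) (bT : is_bst T).

Lemma tau_sub_ge P X S :
  (total_cost A T X)%:R - e%:R * n%:R <=
    c * tau_sub tau T (P ++ X ++ S) (size P) (size X).
Proof.
rewrite lerBlDr; apply: le_trans (lb_sub lb P X S n_gt0 bT).
exact: (lb_total lb).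
Qed.

(** Single amortized bounds may be negative; this limits what a contiguous piece can take away. *)
Lemma tau_sub_ge0 P X S :
  - (e%:R * n%:R) <= c * tau_sub tau T (P ++ X ++ S) (size P) (size X).
Proof. by apply: le_trans (tau_sub_ge P X S); rewrite lerDr. Qed.

(** By [lb_sub] a good piece contributes at least [(c + e) * n]; the accesses after it, up to the
    next piece, take away at most [e * n]. What is left is [c * n], whence the threshold
    [c + 2 * e]. *)
Lemma packs_tau_sub (good : seq 'I_n -> Prop) k P Z S :
  (forall G, good G -> (c + 2 * e%:R) * n%:R <= tau_total tau f T G) ->
  packs good k Z ->
  c * (k%:R * n%:R) <=
    c * tau_sub tau T (P ++ Z ++ S) (size P) (size Z) + e%:R * n%:R.
Proof.
move=> Hgood; elim: k Z S => [|k IH] Z S /=.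
  by move=> _; have := tau_sub_ge0 P Z S; rewrite mul0r mulr0; lra.
move=> [P' [G [S' [-> _ /Hgood gG /IH]]]].
move=> /(_ (G ++ S' ++ S)); rewrite !size_cat !tau_sub_cat.
have := le_trans gG (lb_sub lb (P ++ P') G (S' ++ S) n_gt0 bT).
have := tau_sub_ge0 (P ++ P' ++ G) S' S.
rewrite -!catA !size_cat !addnA -natr1.
by move=> h1 h2 h3; nra.
Qed.

(** The part that costs [K * n] contributes at least [(K - e) * n] to [c] times the bound, and the
    other part takes away at most [e * n]. *)
Lemma tau_total_pair K L G Y :
  c * L + 2 * e%:R <= K%:R ->
  (K * n <= total_cost A T G)%N || (K * n <= total_cost A T Y)%N ->
  L * n%:R <= tau_total tau f T (G ++ Y).
Proof.
move=> HK HGY; rewrite -(ler_pM2l (lb_pos lb)) /tau_total size_cat tau_sub_cat.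
have f0 : 0 <= c * f n by rewrite mulr_ge0 ?(lb_overhead lb n_gt0 bT) // ltW // (lb_pos lb).
have HKn : (c * L + 2 * e%:R) * n%:R <= K%:R * n%:R by rewrite ler_wpM2r.
have [g0 y0] := (tau_sub_ge0 [::] G Y, tau_sub_ge0 G Y [::]).
have [g1 y1] := (tau_sub_ge [::] G Y, tau_sub_ge G Y [::]).
rewrite !cats0 /= in g0 y0 g1 y1; rewrite add0n.
by case/orP: HGY; rewrite -(ler_nat R) natrM => HGY; lra.
Qed.

End OneStructure.

Lemma combination_well_behaved (A : bool -> bst_alg) (tau : bool -> access_bound R) :
  (forall a, online_bst (A a)) -> (forall a, well_behaved (A a) (tau a)) ->
  exists (K : nat) (tauD : access_bound R),
    well_behaved (combination A K) tauD /\
    exists c c' : R, [/\ 0 < c, 0 < c' &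
      forall a n (X P Z S : seq 'I_n) (T : btree 'I_n),
        (0 < n)%N -> X = P ++ Z ++ S -> is_bst T ->
        tau_sub tauD T X (size P) (size Z) <
          c * tau_sub (tau a) T X (size P) (size Z) + c' * n%:R].
Proof.
move=> onA wbA.
have [f0 [c0 [e0 lb0]]] := well_behaved_linearly (wbA false).
have [f1 [c1 [e1 lb1]]] := well_behaved_linearly (wbA true).
pose f a := if a then f1 else f0; pose c a := if a then c1 else c0.
pose e a := if a then e1 else e0.
have lb a : linearly_behaved (A a) (tau a) (f a) (c a) (e a) by case: a.
have c_gt0 a := lb_pos (lb a).
(* [L] exceeds the threshold of [packs_tau_sub] for both structures. *)
pose L := c false + c true + 2 * (e false)%:R + 2 * (e true)%:R.
have L_ge a : c a + 2 * (e a)%:R <= L.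
  have := c_gt0 false; have := c_gt0 true.
  have := ler0n R (e false); have := ler0n R (e true).
  by rewrite /L; case: a; lra.
have L_gt0 : 0 < L.
  by apply: lt_le_trans (L_ge true); rewrite ltr_wpDr ?mulr_ge0.
(* [K] is what [tau_total_pair] demands for both structures; the successor makes it positive. *)
pose K := (Num.bound (c false * L + c true * L + 2 * (e false)%:R + 2 * (e true)%:R)).+1.
have K_ge a : c a * L + 2 * (e a)%:R <= K%:R.
  have h b : 0 <= c b * L by rewrite mulr_ge0 // ltW.
  have [hf ht] := (h false, h true).
  have ef := ler0n R (e false); have et := ler0n R (e true).
  rewrite /K; set s := (X in Num.bound X).
  have s_ge0 : 0 <= s by rewrite /s !addr_ge0 ?hf ?ht ?mulr_ge0.
  have := archi_boundP s_ge0; rewrite -natr1 /s.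
  by case: a; lra.
pose E := (e false + e true)%N.
have access_le a n (T : btree 'I_n) X y : is_bst T -> (size (A a n T (rcons X y)) <= E * n)%N.
  move=> bT; apply: leq_trans (lb_access (lb a) X y bT) _.
  by rewrite leq_mul2r /E; case: a; rewrite ?leq_addr ?leq_addl orbT.
pose good n (T : btree 'I_n) G := forall a, L * n%:R <= tau_total (tau a) (f a) T G.
have good_pair n (T : btree 'I_n) : (0 < n)%N -> is_bst T -> forall G Y,
    (K * n <= total_cost (A false) T G)%N -> (K * n <= total_cost (A true) T Y)%N ->
    good n T (G ++ Y).
  move=> n0 bT G Y hG hY a; apply: (tau_total_pair (lb a) n0 bT (K_ge a)).
  by case: a; rewrite ?hG ?hY ?orbT.
pose C := (2 * (7 + K + E))%N.
pose N n (T : btree 'I_n) X : R := (npack (good n T) X)%:R.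
pose tauD : access_bound R := fun n T X i =>
  C%:R * n%:R * (N n T (take i.+1 X) - N n T (take i X)).
have tauD_sub n (T : btree 'I_n) P X S :
    tau_sub tauD T (P ++ X ++ S) (size P) (size X) =
    C%:R * n%:R * (N n T (P ++ X) - N n T P).
  rewrite /tau_sub /tauD -mulr_sumr telescope_sumr ?leq_addr //.
  by rewrite catA take_size_cat ?size_cat // -catA take_size_cat.
have C_gt0 : 0 < C%:R :> R by rewrite ltr0n.
exists K, tauD; split.
  (* This overhead pays for the successor of [npack] in [total_cost_combination]. *)
  exists (fun n => C%:R * n%:R); split; first by exists C%:R.
  split.
    move=> n T X n0 bT; have := tauD_sub n T [::] X [::].
    rewrite cats0 /tau_total /= => ->; rewrite /N npack0 subr0.
    have := total_cost_combination onA access_le bT n0 (good_pair n T n0 bT) X (ltn0Sn _).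
    by rewrite -(ler_nat R) natrM -[(npack _ _).+1%:R]natr1 mulnA natrM -/C; lra.
  (* Both constants can be 1 because [npack] is superadditive. *)
  exists 1, 1; split=> //.
    move=> n T X i n0 bT lt_i.
    rewrite /access_cost /access_ops (take_nth (Ordinal n0)) //.
    apply: le_trans (_ : ((7 + E) * n)%:R <= _).
      by rewrite ler_nat (size_combination K onA access_le).
    by rewrite mul1r -natrM ler_nat leq_mul2r /C; apply/orP; right; lia.
  move=> n T P X' S n0 bT; rewrite tauD_sub /tau_total.
  have := tauD_sub n T [::] X' [::]; rewrite cats0 /= => ->.
  rewrite !mul1r lerD2r ler_wpM2l ?mulr_ge0 // /N npack0 subr0.
  by rewrite lerBrDl -natrD ler_nat leq_npack_cat.
pose B := (e false)%:R / c false + (e true)%:R / c true.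
have B_ge0 : 0 <= B by rewrite addr_ge0 ?divr_ge0 // ltW.
(* [B] covers the error of [packs_tau_sub] after division by [c a], the next 1 a good piece
   straddling the start of [Z], and the last 1 makes the inequality strict. *)
exists C%:R, (C%:R * (B + 1) + 1); split=> //.
  by rewrite ltr_wpDl // mulr_ge0 // addr_ge0.
move=> a n X P Z S T n0 -> bT; rewrite tauD_sub.
have Hg G : good n T G -> (c a + 2 * (e a)%:R) * n%:R <= tau_total (tau a) (f a) T G.
  by move=> /(_ a); apply: le_trans; rewrite ler_wpM2r.
have := packs_tau_sub (lb a) n0 bT P S Hg (packs_npack (good n T) Z).
set t := tau_sub _ _ _ _ _ => Ht.
have Ht' : N n T Z * n%:R <= t + B * n%:R.
  have Hb : (e a)%:R / c a <= B.
    by rewrite /B; case: (a); rewrite ?lerDl ?lerDr divr_ge0 // ltW.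
  apply: le_trans (_ : t + (e a)%:R / c a * n%:R <= _); last by rewrite lerD2l ler_wpM2r.
  rewrite -(ler_pM2l (c_gt0 a)); apply: le_trans Ht _.
  by rewrite mulrDr mulrA [c a * (_ / _)]mulrC divfK // gt_eqF.
have HN : N n T (P ++ Z) - N n T P <= N n T Z + 1.
  rewrite lerBlDr natr1 -natrD ler_nat; have := npack_cat_leq (good n T) P Z; lia.
have n1 : 0 < n%:R :> R by rewrite ltr0n.
apply: le_lt_trans (_ : C%:R * (t + B * n%:R + n%:R) < _); last by lra.
rewrite -mulrA ler_wpM2l //; apply: le_trans (ler_wpM2l _ HN) _ => //.
by rewrite mulrDr mulr1 lerD2r mulrC.
Qed.

End Bounds.

(** * Machines *)

Section Machine.
Variables (n : nat) (Reg Aug : Type).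

Definition machine_step : Type :=
  'I_n -> Reg -> 'I_n -> Aug -> bool -> bool -> bool -> Reg * Aug * option bst_op.

Definition machine_state : Type := (Reg * {ffun 'I_n -> Aug} * fingered 'I_n)%type.

Definition update (a : {ffun 'I_n -> Aug}) (x : 'I_n) (w : Aug) :
    {ffun 'I_n -> Aug} :=
  [ffun y => if y == x then w else a y].

Lemma update_id a x : update a x (a x) = a.
Proof. by apply/ffunP => y; rewrite ffunE; case: eqP => // ->. Qed.

Lemma update_update a x w w' : update (update a x w) x w' = update a x w'.
Proof. by apply/ffunP => y; rewrite !ffunE; case: eqP. Qed.

Lemma update_at a x w : update a x w x = w.
Proof. by rewrite ffunE eqxx. Qed.

Variable step : machine_step.

Definition decide (y : 'I_n) (s : machine_state) :
    option (Reg * {ffun 'I_n -> Aug} * option bst_op) :=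
  let: (q, a, z) := s in
  if z is (ctx, Node l x r) then
    let: (q', w, o) := step y q x (a x) (is_node l) (is_node r) (0 < size ctx)%N in
    Some (q', update a x w, o)
  else None.

Inductive serves (y : 'I_n) : machine_state -> seq bst_op -> machine_state -> Prop :=
| ServesDone q a z q' a' :
    decide y (q, a, z) = Some (q', a', None) -> serves y (q, a, z) [::] (q', a', z)
| ServesOp q a z q' a' o z' os s' :
    decide y (q, a, z) = Some (q', a', Some o) -> apply_op z o = Some z' ->
    serves y (q', a', z') os s' -> serves y (q, a, z) (o :: os) s'.

Inductive serves_seq : machine_state -> seq 'I_n -> seq (seq bst_op) ->
    machine_state -> Prop :=
| ServesNil s : serves_seq s [::] [::] s
| ServesCons s y os s' X oss s'' :
    serves y s os s' -> serves_seq s' X oss s'' ->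
    serves_seq s (y :: X) (os :: oss) s''.

Lemma serves_seq_rcons s X oss s' y os s'' :
  serves_seq s X oss s' -> serves y s' os s'' ->
  serves_seq s (rcons X y) (rcons oss os) s''.
Proof.
elim=> [s1|s1 y1 os1 s2 X1 oss1 s3 sv _ IH] sv'; last exact: ServesCons sv (IH sv').
exact: ServesCons sv' (ServesNil _).
Qed.

(* In the middle of an access, the operations [os] lead from [s] to [s']. *)
Definition reach y s os s' : Prop :=
  forall os' s'', serves y s' os' s'' -> serves y s (os ++ os') s''.

Lemma reach_trans y s os1 s1 os2 s2 :
  reach y s os1 s1 -> reach y s1 os2 s2 -> reach y s (os1 ++ os2) s2.
Proof. by move=> r1 r2 os' s'' sv; rewrite -catA; apply/r1/r2. Qed.

Lemma reach_refl y s : reach y s [::] s.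
Proof. by []. Qed.

Lemma reach_op y q a z q' a' o z' :
  decide y (q, a, z) = Some (q', a', Some o) -> apply_op z o = Some z' ->
  reach y (q, a, z) [:: o] (q', a', z').
Proof. by move=> e1 e2 os' s''; apply: ServesOp e1 e2. Qed.

Lemma reach_cons y q a z q' a' o z' os s :
  decide y (q, a, z) = Some (q', a', Some o) -> apply_op z o = Some z' ->
  reach y (q', a', z') os s -> reach y (q, a, z) (o :: os) s.
Proof. by move=> e1 e2; apply: reach_trans (reach_op e1 e2). Qed.

(** Lets a proof change the mode without an operation, where two modes take the same decision. *)
Lemma reach_silent y q1 a1 q2 a2 z :
  decide y (q1, a1, z) = decide y (q2, a2, z) -> reach y (q1, a1, z) [::] (q2, a2, z).
Proof.
move=> e os s'' sv; move Es2 : (q2, a2, z) sv => s2 sv.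
case: sv Es2 e => [q a z1 q' a' e1|q a z1 q' a' o z' os' s' e1 e2 sv'] [-> -> ->].
  by rewrite e1 => e0; exact: ServesDone e0.
by rewrite e1 => e0; exact: ServesOp e0 e2 sv'.
Qed.

End Machine.

(** * Determinism of real-world machines *)

Section RwDeterminism.
Variables (b k : nat) (M : rw_machine b k) (n : nat).

Lemma rw_access_det y (s : rw_state b k n) os1 s1 os2 s2 :
  rw_access M y s os1 s1 -> rw_access M y s os2 s2 -> os1 = os2 /\ s1 = s2.
Proof.
move=> r1; elim: r1 os2 s2 => {s os1 s1} [s q a e|s q a o z os s' e e' _ IH] os2 s2 r2.
  by case: r2 e => [s1 q1 a1 e1|s1 q1 a1 o1 z1 os1 s1' e1 e1' _]; rewrite e1 => // -[-> ->].
case: r2 e e' IH => [s1 q1 a1 e1|s1 q1 a1 o1 z1 os1 s1' e1 e1' r]; rewrite e1 => // -[<- <- <-].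
by rewrite e1' => -[<-] IH; have [-> ->] := IH _ _ r.
Qed.

(** [real_world] gives a separate run for each sequence; by determinism, the run on [rcons X y]
    extends the one on [X]. *)
Lemma rw_run_rcons_inv (s : rw_state b k n) X y oss os s1 s2 :
  rw_run M s X oss s1 -> rw_run M s (rcons X y) (rcons oss os) s2 ->
  rw_access M y s1 os s2.
Proof.
elim=> {s X oss s1} [s|s x os1 s1 X oss s3 acc _ IH] /= r.
  by inversion r as [|? ? ? s' ? ? ? acc r']; subst; inversion r'; subst.
inversion r as [|? ? ? s' ? ? ? acc' r']; subst.
by have [_ es] := rw_access_det acc acc'; rewrite -es in r'; apply: IH.
Qed.

End RwDeterminism.

(** * A simulated machine inside a larger state *)

Section Component.
Variables (b k : nat) (M : rw_machine b k) (n : nat) (Q G : Type).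
Variables (getQ : Q -> k.-tuple (word b n)) (setQ : Q -> k.-tuple (word b n) -> Q).
Variables (getG : G -> word b n) (setG : G -> word b n -> G).
Hypotheses (getQK : forall q r, getQ (setQ q r) = r)
           (getGK : forall g w, getG (setG g w) = w).

Definition component_step : machine_step n Q G := fun y q x g hl hr hp =>
  let: (r, w, o) := rw_step M y (getQ q) (NodeView x (getG g) hl hr hp) in
  (setQ q r, setG g w, o).

Definition component_state (q : Q) (gs : {ffun 'I_n -> G}) z : rw_state b k n :=
  RwState (getQ q) [ffun x => getG (gs x)] z.

Lemma component_decide y q gs z regs aug o :
  rw_decide M y (component_state q gs z) = Some (regs, aug, o) ->
  exists q' (gs' : {ffun 'I_n -> G}), [/\ regs = getQ q', aug = [ffun x => getG (gs' x)] &
    decide component_step y (q, gs, z) = Some (q', gs', o)].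
Proof.
rewrite /rw_decide /decide /component_step /=.
case: z => ctx [|l x r] //; rewrite ffunE.
case: (rw_step _ _ _ _) => [[rg w] o'] [<- <- <-].
exists (setQ q rg), (update gs x (setG (gs x) w)); split=> //.
by apply/ffunP => u; rewrite !ffunE; case: eqP => // ->.
Qed.

Lemma component_serves y q gs z os s' :
  rw_access M y (component_state q gs z) os s' ->
  exists q' gs', s' = component_state q' gs' (st_tree s') /\
    serves component_step y (q, gs, z) os (q', gs', st_tree s').
Proof.
move Es : (component_state _ _ _) => s acc.
elim: acc q gs z Es => {s os s'} [s regs aug e|s regs aug o z' os s' e e' _ IH] q gs z Es.
  rewrite -Es in e *; have [q' [gs' [-> -> e0]]] := component_decide e.
  by exists q', gs'; split=> //; apply: ServesDone.
rewrite -Es in e e'; have [q' [gs' [er ea e0]]] := component_decide e.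
have [|q2 [gs2 [e2 sv]]] := IH q' gs' z'; first by rewrite er ea.
by exists q2, gs2; split=> //; apply: ServesOp e0 e' sv.
Qed.

Lemma component_run A (T : btree 'I_n) Y y q gs z :
  (exists s, rw_run M (rw_init M T) (rcons Y y) (access_list A T (rcons Y y)) s) ->
  rw_run M (rw_init M T) Y (access_list A T Y) (component_state q gs z) ->
  exists q' gs' z',
    serves component_step y (q, gs, z) (A n T (rcons Y y)) (q', gs', z') /\
    rw_run M (rw_init M T) (rcons Y y) (access_list A T (rcons Y y))
      (component_state q' gs' z').
Proof.
move=> [s]; rewrite access_list_rcons => run2 run1.
have acc := rw_run_rcons_inv run1 run2.
have [q' [gs' [es sv]]] := component_serves acc.
by exists q', gs', (st_tree s); rewrite -es; split.
Qed.

End Component.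

(** * The machine of the combined algorithm *)

(* The modes of the combined machine: [MUp] climbs to the root, [MDown] descends
   the right spine, the [MUnb] modes run [expose_ops] while counting its
   rotations ([MUnbL] and [MUnbR] are its intermediate positions), [MNext] leaves
   an exposed node, [MBuild] and [MRot] run [build_ops], [MTop] climbs back to
   the root and [MSim] simulates. *)
Inductive mode (m : nat) :=
| MUp | MDown | MUnb of 'I_m | MUnbL of 'I_m | MUnbR of 'I_m
| MNext | MBuild | MRot of 'I_m | MTop | MSim.
Arguments MUp {m}. Arguments MDown {m}. Arguments MNext {m}.
Arguments MBuild {m}. Arguments MTop {m}. Arguments MSim {m}.

Definition mode_code m (x : mode m.+1) : 'I_10 * 'I_m.+1 :=
  match x with
  | MUp => (inord 0, ord0) | MDown => (inord 1, ord0)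
  | MUnb j => (inord 2, j) | MUnbL j => (inord 3, j) | MUnbR j => (inord 4, j)
  | MNext => (inord 5, ord0) | MBuild => (inord 6, ord0) | MRot j => (inord 7, j)
  | MTop => (inord 8, ord0) | MSim => (inord 9, ord0)
  end.

Definition mode_decode m (c : 'I_10 * 'I_m.+1) : mode m.+1 :=
  let: (i, j) := c in
  match nat_of_ord i with
  | 0 => MUp | 1 => MDown | 2 => MUnb j | 3 => MUnbL j | 4 => MUnbR j
  | 5 => MNext | 6 => MBuild | 7 => MRot j | 8 => MTop | _ => MSim
  end.

Lemma mode_codeK m : cancel (@mode_code m) (@mode_decode m).
Proof. by case=> [||j|j|j|||j||]; rewrite /= inordK. Qed.

HB.instance Definition _ m := Finite.copy (mode m.+1) (can_type (@mode_codeK m)).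

Lemma card_mode m : #|{: mode m.+1}| <= 10 * m.+1.
Proof.
apply: leq_trans (leq_card _ (can_inj (@mode_codeK m))) _.
by rewrite card_prod !card_ord.
Qed.

Fixpoint left_spines (K : Type) (t : btree K) : seq (K * nat) :=
  if t is Node l x r then left_spines l ++ (x, spine_size l) :: left_spines r
  else [::].

Lemma unzip1_left_spines (K : Type) (t : btree K) : unzip1 (left_spines t) = inorder t.
Proof. by elim: t => //= l IHl x r IHr; rewrite /unzip1 map_cat /= -IHl -IHr. Qed.

Section CombinedMachine.
Variables (n K : nat) (Q G : Type) (q0 : Q) (g0 : G).
Variable sim : bool -> machine_step n Q G.

(** The booleans are the simulated structure and the first-phase flag; then come the count of
    simulated operations in the phase, truncated at [K * n], and the simulated registers. *)
Definition comb_reg : Type := (mode n.+1 * bool * bool * 'I_(K * n).+1 * Q)%type.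
Definition comb_aug : Type := (G * 'I_n.+1)%type.
Implicit Types (aug : {ffun 'I_n -> comb_aug}) (T S V : btree 'I_n).

(* [first] holds during the first phase, whose reset records the initial tree
   in the augmented data. *)
Section Handlers.
Variables (y x : 'I_n) (hl hr hp : bool) (a first : bool).
Implicit Type gc : comb_aug.

Definition reset_reg (m : mode n.+1) : comb_reg := (m, a, first, ord0, q0).

Definition on_sim (cnt : 'I_(K * n).+1) (q : Q) gc :
    comb_reg * comb_aug * option bst_op :=
  let: (q', g', o) := sim a y q x gc.1 hl hr hp in
  (if o is Some _ then (MSim, a, first, inord (minn cnt.+1 (K * n)), q')
   else if (K * n <= cnt)%N then (MUp, ~~ a, false, ord0, q0)
   else (MSim, a, first, cnt, q'), (g', gc.2), o).

(** A step must perform an operation or end the access, so a handler that has nothing left to do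
    calls the next one at once. *)
Definition on_top gc :=
  if hp then (reset_reg MTop, gc, Some MoveUp) else on_sim ord0 q0 gc.

Definition on_rot (j : 'I_n.+1) gc :=
  if (0 < j)%N then (reset_reg (MRot (inord j.-1)), gc, Some Rotate)
  else if hr then (reset_reg MBuild, gc, Some MoveRight) else on_top gc.

Definition on_next gc :=
  if hp then (reset_reg (MUnb ord0), gc, Some MoveUp) else on_rot gc.2 gc.

Definition on_unb (j : 'I_n.+1) gc :=
  if hl then (reset_reg (MUnbL j), gc, Some MoveLeft)
  (* Every node is exposed once in a reset, so this also reinitializes all simulated augmented
     data. *)
  else on_next (g0, if first then j else gc.2).

Definition on_down gc :=
  if hr then (reset_reg MDown, gc, Some MoveRight) else on_unb ord0 gc.

Definition on_up gc :=
  if hp then (reset_reg MUp, gc, Some MoveUp) else on_down gc.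

End Handlers.

Definition comb_step : machine_step n comb_reg comb_aug := fun y r x gc hl hr hp =>
  let: (m, a, first, cnt, q) := r in
  match m with
  | MUp => on_up y x hl hr hp a first gc
  | MDown => on_down y x hl hr hp a first gc
  | MUnb j => on_unb y x hl hr hp a first j gc
  | MUnbL j => (reset_reg a first (MUnbR j), gc, Some Rotate)
  | MUnbR j => (reset_reg a first (MUnb (inord j.+1)), gc, Some MoveRight)
  | MNext => on_next y x hl hr hp a first gc
  | MBuild => on_rot y x hl hr hp a first gc.2 gc
  | MRot j => on_rot y x hl hr hp a first j gc
  | MTop => on_top y x hl hr hp a first gc
  | MSim => on_sim y x hl hr hp a first cnt q gc
  end.

(** * Correctness of the reset *)

Section Reset.
Variables (y : 'I_n) (a first : bool).
Local Notation reaches := (reach comb_step y).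
Local Notation r := (reset_reg a first).

Lemma reach_expose aug ctx l x t (j : nat) : (j + spine_size l <= n)%N ->
  reaches (r (MUnb (inord j)), aug, (ctx, Node l x t)) (expose_ops l)
    (r (MUnb (inord (j + spine_size l))), aug, (spine l ++ ctx, Node Leaf x t)).
Proof.
elim: l j ctx => [|s _ p b IH] j ctx /= le_j; first by rewrite addn0; apply: reach_refl.
eapply reach_cons; [by rewrite /= update_id | by [] |].
eapply reach_cons; [by rewrite /= update_id | by [] |].
eapply reach_cons; [by rewrite /= update_id | by [] |].
rewrite -catA addnS -addSn inordK; last by lia.
by apply: IH; lia.
Qed.

(* What leaving an exposed node writes: [unbuild_ops] treats the nodes from right
   to left, as [foldr] does. *)
Definition record aug (s : seq ('I_n * nat)) : {ffun 'I_n -> comb_aug} :=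
  foldr (fun xc aug' =>
    update aug' xc.1 (g0, if first then inord xc.2 else (aug' xc.1).2)) aug s.

Lemma reach_unbuild_left aug ctx l x t : (spine_size l <= n)%N ->
  reaches (r (MUnb ord0), aug, (ctx, Node l x t)) (expose_ops l)
    (r MNext, record aug [:: (x, spine_size l)], (spine l ++ ctx, Node Leaf x t)).
Proof.
move=> le_l; rewrite -(cats0 (expose_ops l)).
have -> : ord0 = inord 0 :> 'I_n.+1 by apply/val_inj; rewrite /= inordK.
apply: reach_trans; first exact: reach_expose.
apply: reach_silent; rewrite /= /on_unb update_at.
by case: (on_next _ _ _ _ _ _ _ _) => [[q w] o]; rewrite update_update.
Qed.

Lemma reach_unbuild aug ctx S V : is_node V -> (size (inorder S) <= n)%N ->
  reaches (r MNext, aug, (spine S ++ ctx, V)) (unbuild_ops S)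
    (r MNext, record aug (left_spines S), (ctx, vine (inorder S) V)).
Proof.
elim: S aug ctx V => [|l IHl x t IHt] aug ctx V nV; first by move=> _; apply: reach_refl.
rewrite [inorder _]/= size_cat /= => le_n; rewrite -catA.
apply: reach_trans (IHt _ _ _ nV _) _; first by lia.
have := vine_is_node (inorder t) nV; case ev: (vine _ _) => [//|l' x' r'] _.
eapply reach_cons; [by rewrite /= update_id | by [] |].
have := spine_size_le l => le_l.
apply: reach_trans (reach_unbuild_left _) _; first by lia.
rewrite vine_cat ev /record foldr_cat; apply: IHl => //; lia.
Qed.

Lemma reach_flatten aug ctx S : is_node S -> (size (inorder S) <= n)%N ->
  reaches (r MDown, aug, (ctx, S)) (flatten_ops S)
    (r MNext, record aug (left_spines S), (ctx, vine (inorder S) Leaf)).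
Proof.
elim: S aug ctx => [//|l _ x t IHt] aug ctx _.
rewrite [inorder _]/= size_cat /= => le_n.
have le_l := spine_size_le l.
have E aug' V : reaches (r (MUnb ord0), aug', (ctx, Node l x V))
    (expose_ops l ++ unbuild_ops l)
    (r MNext, record aug' (left_spines l ++ [:: (x, spine_size l)]),
     (ctx, vine (inorder l) (Node Leaf x V))).
  apply: reach_trans (reach_unbuild_left _) _; first by lia.
  rewrite /record foldr_cat; apply: reach_unbuild => //; lia.
have -> : record aug (left_spines l ++ (x, spine_size l) :: left_spines t) =
    record (record aug (left_spines t)) (left_spines l ++ [:: (x, spine_size l)]).
  by rewrite /record !foldr_cat.
rewrite vine_cat; apply: reach_trans (E _ _).
case: t IHt le_n => [|t1 u t2] IHt le_n; first exact: reach_silent.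
eapply reach_cons; [by rewrite /= update_id | by [] |].
apply: reach_trans (IHt _ _ _ _) _ => //; first by lia.
have : is_node (vine (inorder (Node t1 u t2)) Leaf) by rewrite /= vine_cat vine_is_node.
case: (vine _ _) => [//|l' x' r'] _.
by apply: reach_op; rewrite /= ?update_id.
Qed.

Definition recorded aug T : Prop :=
  forall x c, (x, c) \in left_spines T -> (aug x).2 = inord c.

(** The surplus [j] serves the induction, which splits off the top of the spine, the node rotated
    last. *)
Lemma reach_climb aug ctx l t x V j : (j + spine_size l <= n)%N ->
  reaches (r (MRot (inord (j + spine_size l))), aug, (spine l ++ ctx, Node t x V))
    (nseq (spine_size l) Rotate)
    (r (MRot (inord j)), aug,
     (ctx, Node (foldl (fun t f => plug f t) t (spine l)) x V)).
Proof.
elim: l ctx t j => [|s _ p b IH] ctx t j le_j.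
  by rewrite [spine_size _]/= addn0; apply: reach_refl.
rewrite [spine _]/= [spine_size _]/= addnS -addSn.
rewrite -[in nseq _ _](addn1 (spine_size b)) nseqD -catA.
move: le_j; rewrite [spine_size _]/= => le_j.
apply: reach_trans (IH _ _ j.+1 _) _; first by lia.
apply: reach_op; last by rewrite /= foldl_cat.
by rewrite /= /on_rot inordK /= ?update_id //; lia.
Qed.

Lemma reach_place aug ctx l x V : (spine_size l <= n)%N ->
  (aug x).2 = inord (spine_size l) ->
  reaches (r MBuild, aug, (spine l ++ ctx, Node Leaf x V))
    (nseq (spine_size l) Rotate)
    (r (MRot ord0), aug, (ctx, Node l x V)).
Proof.
move=> le_l e; rewrite -[nseq _ _]cat0s.
apply: (reach_trans (s1 := (r (MRot (inord (0 + spine_size l))), aug,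
                            (spine l ++ ctx, Node Leaf x V)))).
  by apply: reach_silent; rewrite /= e.
have := @reach_climb aug ctx l Leaf x V 0 le_l.
have -> : inord 0 = ord0 :> 'I_n.+1 by apply/val_inj; rewrite /= inordK.
by rewrite -[foldl _ _ _]/(whole (spine l, Leaf)) whole_spine.
Qed.

Lemma reach_build aug ctx T V : is_node V -> (size (inorder T) <= n)%N ->
  recorded aug T ->
  reaches (r MBuild, aug, (ctx, vine (inorder T) V)) (build_ops T)
    (r MBuild, aug, (spine T ++ ctx, V)).
Proof.
elim: T ctx V => [|l IHl x t IHt] ctx V nV; first by move=> *; apply: reach_refl.
rewrite [inorder _]/= size_cat /= => le_n rec.
rewrite vine_cat; apply: reach_trans (IHl _ _ _ _ _) _ => //; first by lia.
  by move=> u c uc; apply: rec; rewrite mem_cat uc.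
apply: reach_trans (reach_place _ _) _.
- by have := spine_size_le l; lia.
- by apply: rec; rewrite mem_cat inE eqxx orbT.
have nv := vine_is_node (inorder t) nV.
rewrite -cat1s; apply: (reach_trans (s1 := (r MBuild, aug,
                        (InRight l x :: ctx, vine (inorder t) V)))).
  by case: (vine _ _) nv => [//|? ? ?] _; apply: reach_op; rewrite /= ?update_id.
rewrite -catA; apply: IHt => //; first by lia.
by move=> u c uc; apply: rec; rewrite mem_cat inE uc !orbT.
Qed.

Lemma reach_restore aug ctx T : is_node T -> (size (inorder T) <= n)%N ->
  recorded aug T ->
  reaches (r MBuild, aug, (ctx, vine (inorder T) Leaf)) (restore_ops T)
    (r MTop, aug, (ctx, T)).
Proof.
elim: T ctx => [//|l _ x t IHt] ctx _.
rewrite [inorder _]/= size_cat /= => le_n rec.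
rewrite vine_cat; apply: reach_trans (reach_build _ _ _) _ => //; first by lia.
  by move=> u c uc; apply: rec; rewrite mem_cat uc.
apply: reach_trans (reach_place _ _) _.
- by have := spine_size_le l; lia.
- by apply: rec; rewrite mem_cat inE eqxx orbT.
case: t IHt le_n rec => [|t1 u t2] IHt le_n rec; first exact: reach_silent.
have nv : is_node (vine (inorder (Node t1 u t2)) Leaf) by rewrite /= vine_cat vine_is_node.
rewrite -cat1s; apply: (reach_trans (s1 := (r MBuild, aug,
              (InRight l x :: ctx, vine (inorder (Node t1 u t2)) Leaf)))).
  by case: (vine _ _) nv => [//|? ? ?] _; apply: reach_op; rewrite /= ?update_id.
apply: reach_trans (IHt _ _ _ _) _ => //; first by lia.
  by move=> v c vc; apply: rec; rewrite mem_cat inE vc !orbT.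
by apply: reach_op; rewrite /= ?update_id.
Qed.

Lemma reach_up aug ctx t : is_node t ->
  reaches (r MUp, aug, (ctx, t)) (nseq (size ctx) MoveUp)
    (r MDown, aug, ([::], whole (ctx, t))).
Proof.
rewrite /whole /=; elim: ctx t => [|f ctx IH] [|l x t] // _; first exact: reach_silent.
rewrite [nseq _ _]/= -(cat1s MoveUp).
apply: (reach_trans (s1 := (r MUp, aug, (ctx, plug f (Node l x t))))).
  by case: f => *; apply: reach_op; rewrite /= ?update_id.
by apply: IH; case: (f).
Qed.

Lemma reach_reset aug z T : is_node z.2 -> is_node T ->
  inorder (whole z) = inorder T -> (size (inorder T) <= n)%N ->
  recorded (record aug (left_spines (whole z))) T ->
  reaches (r MUp, aug, z) (reset_ops z T)
    (r MSim, record aug (left_spines (whole z)), ([::], T)).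
Proof.
case: z => ctx t nt nT e le_n rec.
apply: reach_trans (reach_up _) _ => //.
have nw := whole_is_node ctx nt.
apply: reach_trans (reach_flatten _ _) _; rewrite ?e //.
(* The empty lists make room for the silent changes from [MNext] to [MBuild] and from [MTop] to
   [MSim]. *)
rewrite -[restore_ops T]cats0 -[restore_ops T]cat0s -catA.
have nv : is_node (vine (inorder T) Leaf).
  by case: (T) nT => [//|? ? ?] _; rewrite /= vine_cat vine_is_node.
apply: (reach_trans (s1 := (r MBuild, record aug (left_spines (whole (ctx, t))),
                            ([::], vine (inorder T) Leaf)))).
  by case: (vine _ _) nv => [//|? ? ?] _; apply: reach_silent.
apply: reach_trans (reach_restore _ _ _) _ => //.
by case: (T) nT => [//|? ? ?] _; apply: reach_silent.
Qed.

End Reset.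

Lemma record_notin first aug s x : x \notin unzip1 s -> record first aug s x = aug x.
Proof.
elim: s => //= -[x' c] s IH; rewrite inE negb_or => /andP[nx xs].
by rewrite ffunE (negPf nx) IH.
Qed.

Lemma record_in first aug s x c : uniq (unzip1 s) -> (x, c) \in s ->
  record first aug s x = (g0, if first then inord c else (aug x).2).
Proof.
elim: s => //= -[x' c'] s IH /andP[/= nx us]; rewrite inE.
case/predU1P => [[-> ->]|xs]; first by rewrite update_at record_notin.
rewrite ffunE ifN ?IH //; apply: contraNneq nx => <-.
by apply/mapP; exists (x, c).
Qed.

Definition pair_aug (gs : {ffun 'I_n -> G}) (cs : {ffun 'I_n -> 'I_n.+1}) :
    {ffun 'I_n -> comb_aug} :=
  [ffun x => (gs x, cs x)].

Lemma update_pair_aug gs cs x g :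
  update (pair_aug gs cs) x (g, cs x) = pair_aug (update gs x g) cs.
Proof. by apply/ffunP => u; rewrite !ffunE; case: eqP => // ->. Qed.

Lemma serves_apply_ops (Reg Aug : Type) (step : machine_step n Reg Aug) y s os s' :
  serves step y s os s' -> apply_ops s.2 os = Some s'.2.
Proof. by elim=> //= q aug z q' aug' o z' os' s1 _ -> _. Qed.

(** Truncating the counter at [K * n] does not affect its comparison with [K * n]. *)
Lemma serves_sim y a first q gs z os s' cost cs :
  serves (sim a) y (q, gs, z) os s' ->
  serves comb_step y
    ((MSim, a, first, inord (minn cost (K * n)), q), pair_aug gs cs, z) os
    (if (K * n <= cost + size os)%N then reset_reg (~~ a) false MUp
     else (MSim, a, first, inord (minn (cost + size os) (K * n)), s'.1.1),
     pair_aug s'.1.2 cs, s'.2).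
Proof.
move Es : (q, gs, z) => s sv.
have cntK i : (inord (minn i (K * n)) : 'I_(K * n).+1) = minn i (K * n) :> nat.
  by rewrite inordK // ltnS geq_minr.
elim: sv cost q gs z Es => {s os s'}
  [q1 gs1 z1 q' gs' e|q1 gs1 z1 q' gs' o z' os s' e e' sv IH] cost q gs z [-> -> ->].
  rewrite addn0; move: e; rewrite /decide; case: z1 => ctx [|l x t] //.
  case es: (sim _ _ _ _ _ _ _ _) => [[q2 w] o] [<- <- eo].
  apply: ServesDone; rewrite /= /on_sim !ffunE /= es eo -update_pair_aug cntK.
  by rewrite leq_min leqnn andbT.
apply: ServesOp e' _; last first.
  by have := IH cost.+1 q' gs' z' erefl; rewrite addSnnS; apply.
move: e; rewrite /decide; case: z1 => ctx [|l x t] //.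
case es: (sim _ _ _ _ _ _ _ _) => [[q2 w] o'] [<- <- eo].
rewrite /= /on_sim !ffunE /= es eo -update_pair_aug cntK.
by have -> : minn (minn cost (K * n)).+1 (K * n) = minn cost.+1 (K * n) by lia.
Qed.

(** * The machine follows the alternating algorithm *)

Section Simulation.
Variables (A : bool -> bst_alg) (T : btree 'I_n).
Hypotheses (online_A : forall a, online_bst (A a)) (n_gt0 : (0 < n)%N) (bT : is_bst T).
Variable inv : bool -> seq 'I_n -> Q -> {ffun 'I_n -> G} -> fingered 'I_n -> Prop.
Hypothesis inv0 : forall a, inv a [::] q0 [ffun => g0] (finger_at_root T).
Hypothesis inv_step : forall a Y q gs z y, inv a Y q gs z ->
  exists q' gs' z', serves (sim a) y (q, gs, z) (A a T (rcons Y y)) (q', gs', z') /\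
    inv a (rcons Y y) q' gs' z'.

Local Notation sim_reg a first Y q :=
  (MSim, a, first, inord (minn (total_cost (A a) T Y) (K * n)), q).

(** Between phases the simulated augmented data are arbitrary, as the reset overwrites them. Before
    the first reset no counts are stored, but the tree is [T] itself, so flattening it finds the
    right ones. *)
Definition comb_rel (s : comb_state n) (r : comb_reg) aug : Prop :=
  let: (a, Y, z) := s in
  if Y is [::] then
    exists2 first : bool, r = reset_reg a first MUp &
      if first then z = finger_at_root T else recorded aug T
  else exists first q gs cs,
    [/\ r = sim_reg a first Y q, aug = pair_aug gs cs, recorded aug T & inv a Y q gs z].

Lemma comb_rel_prepare a Y z r aug y :
  comb_inv A T (a, Y, z) -> comb_rel (a, Y, z) r aug ->
  exists first q gs cs z1, [/\ recorded (pair_aug gs cs) T, inv a Y q gs z1 &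
    reach comb_step y (r, aug, z) (if Y is [::] then reset_ops z T else [::])
      (sim_reg a first Y q, pair_aug gs cs, z1)].
Proof.
case: Y => [|x Y]; last first.
  move=> _ [first [q [gs [cs [-> -> rec iv]]]]]; exists first, q, gs, cs, z.
  by split=> //; apply: reach_refl.
move=> [/= nz ez _] [first -> rel].
set aug' := record first aug (left_spines (whole z)).
have uS : uniq (unzip1 (left_spines (whole z))).
  by rewrite unzip1_left_spines ez bT enum_uniq.
have e' : aug' = pair_aug [ffun => g0] [ffun x => (aug' x).2].
  apply/ffunP => x; rewrite !ffunE.
  have : x \in unzip1 (left_spines (whole z)).
    by rewrite unzip1_left_spines ez bT mem_enum.
  by case/mapP => -[x' c] xc /= ->; rewrite /aug' (record_in _ _ uS xc).
have rec : recorded aug' T.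
  move=> x c xc; rewrite /aug'; case: first @aug' rel e' => aug' rel e'.
    by rewrite rel in uS *; rewrite (record_in _ _ uS xc).
  have : x \in unzip1 (left_spines (whole z)).
    rewrite unzip1_left_spines ez -unzip1_left_spines.
    by apply/mapP; exists (x, c).
  case/mapP => -[x' c'] xc' /= ex; rewrite ex in xc *.
  by rewrite (record_in _ _ uS xc') /= (rel _ _ xc).
exists first, q0, [ffun => g0], [ffun x => (aug' x).2], (finger_at_root T).
rewrite -e' total_cost_sumn min0n.
have -> : inord 0 = ord0 :> 'I_(K * n).+1 by apply/val_inj; rewrite /= inordK.
split=> //; apply: reach_reset => //; first exact: is_node_bst.
by rewrite size_inorder_bst.
Qed.

Lemma comb_rel_step s r aug y : comb_inv A T s -> comb_rel s r aug ->
  exists r' aug',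
    serves comb_step y (r, aug, s.2) (comb_ops A T s y)
      (r', aug', (comb_next A K T s y).2) /\
    comb_rel (comb_next A K T s y) r' aug'.
Proof.
case: s => [[a Y] z] ci rel.
have [first [q [gs [cs [z1 [rec iv pre]]]]]] := comb_rel_prepare y ci rel.
have [q' [gs' [z' [sv iv']]]] := inv_step y iv.
have := pre _ _ (serves_sim first (total_cost (A a) T Y) cs sv).
rewrite -[_ ++ _]/(comb_ops A T (a, Y, z) y) -total_cost_rcons => sv'.
have := serves_apply_ops sv'; rewrite /comb_next => -> /=.
have rec' : recorded (pair_aug gs' cs) T.
  by move=> x c /rec; rewrite !ffunE.
case: (K * n <= total_cost _ _ _)%N sv' => sv'; eexists; eexists; split; try exact: sv'.
  by exists false.
rewrite /comb_rel; case: (rcons Y y) (size_rcons Y y) iv' {sv sv'} => // x Y' _ iv'.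
by exists first, q', gs', cs.
Qed.

Lemma comb_machine_run p : exists r aug,
  serves_seq comb_step (reset_reg false true MUp, [ffun => (g0, ord0)], finger_at_root T)
    p (access_list (combination A K) T p) (r, aug, (comb_run A K T p).2) /\
  comb_rel (comb_run A K T p) r aug.
Proof.
elim/last_ind: p => [|p y [r [aug [sv rel]]]].
  exists (reset_reg false true MUp), [ffun => (g0, ord0)]; split; first exact: ServesNil.
  by exists true.
have [r' [aug' [sv' rel']]] :=
  comb_rel_step y (comb_inv_run K online_A p n_gt0 bT) rel.
exists r', aug'; rewrite comb_run_rcons access_list_rcons combination_rcons.
by split=> //; apply: serves_seq_rcons sv sv'.
Qed.

End Simulation.
End CombinedMachine.

(** * Encoding in words *)

Section Encoding.
Variables (F W : finType) (le_FW : #|F| <= #|W|).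

Definition encode (x : F) : W := enum_val (widen_ord le_FW (enum_rank x)).

Lemma encode_inj : injective encode.
Proof.
move=> x y /enum_val_inj /(congr1 val) /= e.
exact/enum_rank_inj/val_inj.
Qed.

Definition decode (x0 : F) (w : W) : F := odflt x0 [pick x | encode x == w].

Lemma encodeK x0 : cancel encode (decode x0).
Proof.
move=> x; rewrite /decode; case: pickP => [y /eqP/encode_inj //|/(_ x)].
by rewrite eqxx.
Qed.

End Encoding.

(** * Compiling a machine on finite types to one on words *)

Section Compilation.
Variables (b : nat) (Reg Aug : nat -> finType).
Variables (r0 : forall n, Reg n) (a0 : forall n, Aug n).
Variable step : forall n, machine_step n (Reg n) (Aug n).
Hypotheses (leR : forall n, #|Reg n| <= #|{: word b n}|)
           (leA : forall n, #|Aug n| <= #|{: word b n}|).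

Definition compiled : rw_machine b 1 :=
  RwMachine (fun n => [tuple encode (leR n) (r0 n)])
    (fun n => encode (leA n) (a0 n))
    (fun n y regs v =>
       let: (q, w, o) := step y (decode (leR n) (r0 n) (thead regs)) (view_key v)
         (decode (leA n) (a0 n) (view_aug v)) (view_has_left v)
         (view_has_right v) (view_has_parent v) in
       ([tuple encode (leR n) q], encode (leA n) w, o)).

Definition compiled_state n (s : machine_state n (Reg n) (Aug n)) : rw_state b 1 n :=
  let: (q, a, z) := s in
  RwState [tuple encode (leR n) q] [ffun x => encode (leA n) (a x)] z.

Lemma compiled_decide n y (q : Reg n) a z q' a' o :
  decide (@step n) y (q, a, z) = Some (q', a', o) ->
  rw_decide compiled y (compiled_state (q, a, z)) =
    Some ([tuple encode (leR n) q'], [ffun x => encode (leA n) (a' x)], o).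
Proof.
rewrite /rw_decide /=; case: z => ctx [|l x r] //=.
rewrite ffunE theadE !encodeK.
case: (step _ _ _ _ _ _ _) => [[q1 w] o1] [<- <- <-].
by congr (Some (_, _, _)); apply/ffunP => u; rewrite !ffunE; case: eqP.
Qed.

Lemma compiled_access n y s os s' : serves (@step n) y s os s' ->
  rw_access compiled y (compiled_state s) os (compiled_state s').
Proof.
elim=> [q a z q' a' /compiled_decide e|q a z q' a' o z' os' s1 /compiled_decide e e' _ IH].
  exact: RwDone e.
exact: RwOp e e' IH.
Qed.

Lemma compiled_run n s X oss s' : serves_seq (@step n) s X oss s' ->
  rw_run compiled (compiled_state s) X oss (compiled_state s').
Proof.
elim=> [s1|s1 y os s2 X1 oss1 s3 sv _ IH]; first exact: RwNil.
exact: RwCons (compiled_access sv) IH.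
Qed.

Lemma compiled_init n (T : btree 'I_n) :
  compiled_state (r0 n, [ffun => a0 n], finger_at_root T) = rw_init compiled T.
Proof.
by congr RwState; apply/ffunP => x; rewrite !ffunE.
Qed.

End Compilation.

(** * The real-world implementation *)

Lemma card_word b n : #|{: word b n}| = 2 ^ (b * (trunc_log 2 n).+1).
Proof. by rewrite card_tuple card_bool. Qed.

Lemma real_world_combination (A : bool -> bst_alg) K :
  (forall a, online_bst (A a)) -> (forall a, real_world (A a)) ->
  real_world (combination A K).
Proof.
move=> onA rwA.
have [b0 [k0 [M0 run0]]] := rwA false; have [b1 [k1 [M1 run1]]] := rwA true.
(* One register holds everything: 7 for the mode and the two booleans, [K] for the counter, the
   products for the simulated registers. The augmented data need [b0 + b1], and 1 for the recorded
   count. *)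
pose b := 7 + K + k0 * b0 + k1 * b1 + b0 + b1.
pose Q n : finType := (k0.-tuple (word b0 n) * k1.-tuple (word b1 n))%type.
pose G n : finType := (word b0 n * word b1 n)%type.
pose q0 n : Q n := (rw_reg0 M0 n, rw_reg0 M1 n).
pose g0 n : G n := (rw_aug0 M0 n, rw_aug0 M1 n).
pose sim n a : machine_step n (Q n) (G n) :=
  if a then component_step M1 snd (fun q r => (q.1, r)) snd (fun g w => (g.1, w))
  else component_step M0 fst (fun q r => (r, q.2)) fst (fun g w => (w, g.2)).
pose Reg n : finType := (mode n.+1 * bool * bool * 'I_(K * n).+1 * Q n)%type.
pose Aug n : finType := (G n * 'I_n.+1)%type.
have lt_n n : n < 2 ^ (trunc_log 2 n).+1 by apply: trunc_log_ltn.
have leA n : #|Aug n| <= #|{: word b n}|.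
  rewrite card_word /Aug /G /= !card_prod !card_tuple card_bool card_ord -!expnD -!mulnDl.
  apply: leq_trans (leq_mul (leqnn _) (lt_n n)) _.
  by rewrite -expnD leq_exp2l // -mulSnr leq_mul2r /b; apply/orP; right; lia.
have leR n : #|Reg n| <= #|{: word b n}|.
  rewrite card_word /Reg /Q /= !card_prod !card_tuple !card_ord card_bool -!expnM.
  have le_mode : #|{: mode n.+1}| * 2 * 2 <= 2 ^ (7 * (trunc_log 2 n).+1).
    have := card_mode n => le_m.
    apply: (@leq_trans (2 ^ 6 * 2 ^ (trunc_log 2 n).+1)); first by have := lt_n n; lia.
    by rewrite -expnD leq_exp2l //; lia.
  (* Through [n.+1 ^ K], which is at least [(K * n).+1] by Bernoulli's inequality. *)
  have le_cnt : (K * n).+1 <= 2 ^ (K * (trunc_log 2 n).+1).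
    rewrite [leqRHS](_ : _ = (2 ^ (trunc_log 2 n).+1) ^ K); last by rewrite -expnM mulnC.
    apply: (@leq_trans (n.+1 ^ K)); last first.
      by case: (K) => [//|i]; rewrite leq_exp2r // lt_n.
    elim: (K) => [|i IH]; first by rewrite mul0n.
    rewrite expnS; apply: leq_trans (leq_mul (leqnn _) IH); nia.
  apply: leq_trans (leq_mul (leq_mul le_mode le_cnt) (leqnn _)) _.
  rewrite -!expnD leq_exp2l // !(mulnAC _ (trunc_log 2 n).+1) -!mulnDl.
  by rewrite leq_mul2r /b; apply/orP; right; lia.
pose step n : machine_step n (Reg n) (Aug n) :=
  @comb_step n K (Q n) (G n) (q0 n) (g0 n) (sim n).
exists b, 1, (compiled (fun n => reset_reg K (q0 n) false true MUp)
                       (fun n => (g0 n, ord0)) step leR leA).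
move=> n T X n0 bT.
pose inv a Y (q : Q n) (gs : {ffun 'I_n -> G n}) z :=
  if a then rw_run M1 (rw_init M1 T) Y (access_list (A true) T Y)
    (component_state snd snd q gs z)
  else rw_run M0 (rw_init M0 T) Y (access_list (A false) T Y)
    (component_state fst fst q gs z).
have inv0 a : inv a [::] (q0 n) [ffun => g0 n] (finger_at_root T).
  rewrite /inv; case: a.
    have -> : component_state snd snd (q0 n) [ffun => g0 n] (finger_at_root T) = rw_init M1 T.
      by congr RwState; apply/ffunP => x; rewrite !ffunE.
    exact: RwNil.
  have -> : component_state fst fst (q0 n) [ffun => g0 n] (finger_at_root T) = rw_init M0 T.
    by congr RwState; apply/ffunP => x; rewrite !ffunE.
  exact: RwNil.
have inv_step a Y q gs z y : inv a Y q gs z ->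
  exists q' (gs' : {ffun 'I_n -> G n}) z',
    serves (sim n a) y (q, gs, z) (A a n T (rcons Y y)) (q', gs', z') /\
    inv a (rcons Y y) q' gs' z'.
  by rewrite /inv /sim; case: a => iv; apply: component_run => //; [apply: run1 | apply: run0].
have [r [aug [sv _]]] := comb_machine_run K onA n0 bT inv0 inv_step X.
exists (compiled_state leR leA (r, aug, (comb_run A K T X).2)).
by rewrite -compiled_init; apply: (compiled_run _ _ _ _ sv).
Qed.

(** * Assembling the combined structure *)

Local Open Scope ring_scope.

Theorem theorem39 (R : realType) (A0 A1 : bst_alg) (tau0 tau1 : access_bound R)
    (online0 : online_bst A0) (online1 : online_bst A1)
    (wb0 : well_behaved A0 tau0) (wb1 : well_behaved A1 tau1) :
  exists (D : bst_alg) (tauD : access_bound R),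
    [/\ online_bst D,
        well_behaved D tauD,
        exists c c' : R,
          [/\ 0 < c, 0 < c' &
              forall (n : nat) (X P Z S : seq 'I_n) (T : btree 'I_n),
                (0 < n)%N -> X = P ++ Z ++ S -> is_bst T ->
                tau_sub tauD T X (size P) (size Z) <
                  c * Num.min (tau_sub tau0 T X (size P) (size Z))
                              (tau_sub tau1 T X (size P) (size Z))
                  + c' * n%:R] &
        real_world A0 -> real_world A1 -> real_world D].
Proof.
pose A a := if a then A1 else A0; pose tau a := if a then tau1 else tau0.
have onA a : online_bst (A a) by case: a.
have wbA a : well_behaved (A a) (tau a) by case: a.
have [K [tauD [wbD [c [c' [c0 c'0 bound]]]]]] := combination_well_behaved onA wbA.
exists (combination A K), tauD; split=> //; first exact: online_combination.
  exists c, c'; split=> // n X P Z S T n0 eX bT.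
  have b0 := bound false n X P Z S T n0 eX bT.
  have b1 := bound true n X P Z S T n0 eX bT.
  by rewrite minEle; case: ifP.
by move=> rw0 rw1; apply: real_world_combination => //; case.
Qed.
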